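(* Let $\Omega=(0,1)\times(0,1)$ and $\Gamma=\{(x,y)\in\Omega: x=y\}$. Let $f\in L^2(\Omega)$, or let $f$ be a continuous functional on $H^1_0(\Omega)$, and let $u\in H^1_0(\Omega)$ be the (weak) solution of $-\Delta u=f$ in $\Omega$, $u=0$ on $\partial\Omega$. Then $$\int_\Gamma u\,ds=\frac1{\sqrt2}\int_\Omega f\,G\,dx\,dy=\frac1{\sqrt2}\int_\Omega\nabla u\cdot\nabla G\,dx\,dy,$$ where $G$ is the function on $\Omega$ given by $G(x,y)=y(1-x)$ if $0\le y\le x$ and $G(x,y)=x(1-y)$ if $x<y\le1$.
   Context: The weak solution $u\in H^1_0(\Omega)$ is the unique function satisfying $\int_\Omega\nabla u\cdot\nabla v=(f,v)$ for all $v\in H^1_0(\Omega)$, where $(f,v)=\int_\Omega f v$ when $f\in L^2(\Omega)$; when $f$ is a continuous functional on $H_0^1(\Omega)$, $(f,v)$ and $\int_\Omega f v$ denote the action of $f$ on $v$. The function $G$ belongs to $H^1_0(\Omega)$. The integral $\int_\Gamma u\,ds$ is the line integral with respect to arc length of the trace of $u$ on $\Gamma$. *)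

(* Defs.v *)
From mathcomp Require Import all_boot all_order all_algebra.
From mathcomp Require Import all_classical all_reals all_analysis.

Set Implicit Arguments.
Unset Strict Implicit.
Unset Printing Implicit Defensive.

Import Order.TTheory GRing.Theory Num.Theory.
Import numFieldNormedType.Exports.

Local Open Scope classical_set_scope.
Local Open Scope ring_scope.

(* Functions on the unit square, and elements of the spaces L^2, H^1, H^1_0,
   are represented by total functions [R * R -> R] whose values outside
   [Omega] are irrelevant; elements of function spaces are not quotiented by
   equality almost everywhere. *)

Section Defs.
Variable R : realType.

Notation plane := (measurableTypeR R * measurableTypeR R)%type.
Notation fieldR2 := (R * R -> R).

Definition Omega : set (R * R) := [set p | 0 < p.1 < 1 /\ 0 < p.2 < 1].

Definition Gamma : set (R * R) := [set p | Omega p /\ p.1 = p.2].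

Notation leb2 := (@lebesgue_measure R \x @lebesgue_measure R)%E.

Definition int_Omega (h : fieldR2) : R := \int[leb2]_(p in (Omega : set plane)) h p.

Definition L2_Omega (u : fieldR2) : Prop :=
  measurable_fun (Omega : set plane) (u : plane -> measurableTypeR R) /\
  leb2.-integrable (Omega : set plane) (fun p => (u p ^+ 2)%:E).

Definition dx (h : fieldR2) : fieldR2 := fun p => derive1 (fun s => h (s, p.2)) p.1.
Definition dy (h : fieldR2) : fieldR2 := fun p => derive1 (fun s => h (p.1, s)) p.2.

Fixpoint Cn (n : nat) (h : fieldR2) : Prop :=
  continuous h /\
  if n is m.+1 then
    [/\ forall p, derivable (fun s => h (s, p.2)) p.1 1,
        forall p, derivable (fun s => h (p.1, s)) p.2 1,
        Cn m (dx h) & Cn m (dy h)]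
  else True.

(* C_c^oo(Omega), extended by zero to the plane *)
Definition test_fun (phi : fieldR2) : Prop :=
  [/\ forall n, Cn n phi,
      compact (closure [set p | phi p != 0]) &
      closure [set p | phi p != 0] `<=` Omega].

(* [g] is the weak derivative of [u] associated with the classical partial
   derivative [d], which is [dx] or [dy]. *)
Definition is_weak_deriv (d : fieldR2 -> fieldR2) (u g : fieldR2) : Prop :=
  L2_Omega g /\
  forall phi, test_fun phi ->
    int_Omega (fun p => u p * d phi p) = - int_Omega (fun p => g p * phi p).

(* A representative of the weak derivative, which is unique up to equality
   almost everywhere; meaningful when the weak derivative exists in L^2. *)
Definition weak_deriv (d : fieldR2 -> fieldR2) (u : fieldR2) : fieldR2 :=
  xget (cst 0) [set g | is_weak_deriv d u g].

Definition grad_dot (u v : fieldR2) : fieldR2 := fun p =>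
  weak_deriv dx u p * weak_deriv dx v p + weak_deriv dy u p * weak_deriv dy v p.

Definition H1 (u : fieldR2) : Prop :=
  [/\ L2_Omega u, exists g, is_weak_deriv dx u g & exists g, is_weak_deriv dy u g].

Definition H1_norm (u : fieldR2) : R :=
  Num.sqrt (int_Omega (fun p => u p ^+ 2 + grad_dot u u p)).

Definition H10 (u : fieldR2) : Prop :=
  H1 u /\
  forall e : R, 0 < e -> exists2 phi, test_fun phi & H1_norm (u \- phi) < e.

Definition continuous_functional_H10 (F : fieldR2 -> R) : Prop :=
  (forall (a : R) v w, H10 v -> H10 w ->
     F (fun p => a * v p + w p) = a * F v + F w) /\
  (forall v, H10 v -> forall e : R, 0 < e -> exists2 delta : R, 0 < delta &
     forall w, H10 w -> H1_norm (w \- v) < delta -> `|F w - F v| < e).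

Inductive source :=
  | Density of fieldR2
  | Functional of (fieldR2 -> R).

Definition admissible (f : source) : Prop :=
  match f with
  | Density h => L2_Omega h
  | Functional F => continuous_functional_H10 F
  end.

(* the pairing (f, v), also written as the integral of f v over Omega *)
Definition pairing (f : source) (v : fieldR2) : R :=
  match f with
  | Density h => int_Omega (fun p => h p * v p)
  | Functional F => F v
  end.

Definition weak_solution (f : source) (u : fieldR2) : Prop :=
  H10 u /\ forall v, H10 v -> int_Omega (grad_dot u v) = pairing f v.

(* parametrization of [Gamma] used for its line integral, see [diag_bij] *)
Definition diag (t : R) : R * R := (t, t).

Lemma diag_bij : set_bij `]0, 1[ Gamma diag.
Proof.
split.
- by move=> t /=; rewrite in_itv /= => t01.
- by move=> s t _ _ [].
- by move=> [x y] [[/= x01 _] /= <-]; exists x => //=; rewrite in_itv.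
Qed.

Definition speed (c : R -> R * R) (t : R) : R :=
  Num.sqrt (derive1 (fun s => (c s).1) t ^+ 2 + derive1 (fun s => (c s).2) t ^+ 2).

(* integral over [Gamma] with respect to arc length *)
Definition int_Gamma (g : fieldR2) : R :=
  \int[lebesgue_measure]_(t in `]0, 1[) (g (diag t) * speed diag t).

Definition L2_Gamma (g : fieldR2) : Prop :=
  measurable_fun (`]0, 1[%classic : set (measurableTypeR R))
    (g \o diag : measurableTypeR R -> measurableTypeR R) /\
  lebesgue_measure.-integrable (`]0, 1[%classic : set (measurableTypeR R))
    (fun t => (g (diag t) ^+ 2 * speed diag t)%:E).

Definition L2_Gamma_norm (g : fieldR2) : R :=
  Num.sqrt (int_Gamma (fun p => g p ^+ 2)).

(* The trace operator is the continuous extension to H^1_0(Omega), with values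
   in L^2(Gamma), of the restriction of test functions to [Gamma]. *)
Definition is_trace (u g : fieldR2) : Prop :=
  L2_Gamma g /\
  exists phi : nat -> fieldR2,
    [/\ forall n, test_fun (phi n),
        H1_norm (phi n \- u) @[n --> \oo] --> (0 : R) &
        L2_Gamma_norm (phi n \- g) @[n --> \oo] --> (0 : R)].

(* a representative of the trace, relevant only on [Gamma] *)
Definition trace (u : fieldR2) : fieldR2 := xget (cst 0) [set g | is_trace u g].

Definition G (p : R * R) : R :=
  if p.2 <= p.1 then p.2 * (1 - p.1) else p.1 * (1 - p.2).

End Defs.

(* Main.v *)
(* The gradient of G is (1_{x <= y} - y, 1_{y < x} - x) almost everywhere, so for
   a test function phi the fundamental theorem of calculus on the horizontal and
   vertical sections of the square gives
     int_Omega (grad phi . grad G) = 2 * int_0^1 phi(t, t) dt.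
   The same identity applied to phi^2 bounds the L^2 norm of phi on the diagonal
   by the H^1 norm of phi.  Hence along test functions converging to u in H^1_0
   the restrictions to the diagonal converge in L^2, which yields the trace of u,
   and both sides of the identity pass to the limit; the arc length element
   sqrt 2 turns the factor 2 into 1 / sqrt 2.  Finally G itself belongs to H^1_0
   (it is a limit of explicit smooth compactly supported functions), so it is
   admissible in the weak formulation and (f, G) is the integral of
   grad u . grad G. *)
Require Import Defs.
From mathcomp Require Import all_boot all_order all_algebra.
From mathcomp Require Import all_classical all_reals all_analysis measurable_realfun.
From mathcomp Require Import ring lra.

Set Implicit Arguments.
Unset Strict Implicit.
Unset Printing Implicit Defensive.

Import Order.TTheory GRing.Theory Num.Theory.
Import numFieldNormedType.Exports.

Local Open Scope classical_set_scope.
Local Open Scope ring_scope.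

(** * Flat functions *)

Section smooth.
Variable R : realType.
Implicit Types (t x : R) (k n : nat) (f g : R -> R) (h : R * R -> R).

(** Both [weak_deriv] and [trace] select an arbitrary representative by [xget], about which only its
    defining property is known. This shapes the proof in two ways. An integral of [grad_dot] can be
    evaluated with explicit gradients only because weak derivatives agree almost everywhere, which
    is the fundamental lemma of the calculus of variations. And the trace identity is proved for
    every [g] with [is_trace u g], while the existence of such a [g] is a separate matter that rests
    on the completeness of L^2(0,1). The kink of [G] on the diagonal is never differentiated: [Gx]
    and [Gy] are identified as weak derivatives because they are the L^2 limits of the gradients of
    the smooth approximations, so one sequence gives both the gradient of [G] and its membership in
    H^1_0. The factor 2 arises because [Gx] on horizontal sections and [Gy] on vertical ones both
    drop by 1 across the diagonal, so each partial derivative contributes one diagonal integral. *)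

Definition flat k t : R := if 0 < t then t ^- k * expR (- t^-1) else 0.

Lemma flat_gt0E k t : 0 < t -> flat k t = t ^- k * expR (- t^-1).
Proof. by rewrite /flat => ->. Qed.

Lemma flat_le0 k t : t <= 0 -> flat k t = 0.
Proof. by rewrite /flat leNgt => /negbTE ->. Qed.

Lemma flat_ge0 k t : 0 <= flat k t.
Proof.
rewrite /flat; case: ifPn => // t0.
by rewrite mulr_ge0 ?expR_ge0// invr_ge0 exprn_ge0// ltW.
Qed.

(** Keeping a single term of the exponential series gives exp (1/t) >= t^-(k+1) / (k+1)!, hence a
    linear bound at the origin. *)
Lemma flat_ub k t : flat k t <= k.+1`!%:R * `|t|.
Proof.
rewrite /flat; case: ifPn => [t0|_]; last by rewrite mulr_ge0.
have ti0 : 0 <= t^-1 by rewrite invr_ge0 ltW.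
have := expR_ge1Dxn k ti0.
move=> /(le_trans (_ : _ <= _)) => /(_ (t^-1 ^+ k.+1 / k.+1`!%:R)).
rewrite lerDr => /(_ ler01).
rewrite expRN gtr0_norm// => H.
have F0 : 0 < k.+1`!%:R :> R by rewrite ltr0n fact_gt0.
rewrite ler_pdivrMr ?expR_gt0//.
apply: le_trans (_ : _ <= k.+1`!%:R * t * (t^-1 ^+ k.+1 / k.+1`!%:R)) _; last first.
  by rewrite ler_wpM2l// mulr_ge0// ltW.
by rewrite le_eqVlt -exprVn exprS; apply/orP; left; apply/eqP; field; rewrite !gt_eqF.
Qed.

Lemma mul_flatS k t : t * flat k.+1 t = flat k t.
Proof.
rewrite /flat; case: ifPn => t0; last by rewrite mulr0.
by rewrite mulrA -!exprVn exprS mulrA divff ?mul1r// gt_eqF.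
Qed.

(** The functions t^-k exp (-1/t) are closed under differentiation up to linear combinations, so
    treating all [k] at once makes smoothness a plain induction. At 0 the difference quotient of
    [flat k] is exactly [flat k.+1], which tends to 0 by [flat_ub]. *)
Lemma is_derive_flat k t :
  is_derive t 1 (flat k) (flat k.+2 t - k%:R * flat k.+1 t).
Proof.
have [t0|t0|<-] := ltgtP 0 t.
- have nt : \forall s \near t, s ^- k * expR (- s^-1) = flat k s.
    by near=> s; rewrite flat_gt0E//; near: s; exact: lt_nbhsr.
  apply: (near_eq_is_derive nt).
  have tn0 : t != 0 by rewrite gt_eqF.
  have dV : is_derive t 1 (fun s => s^-1) (- t^-2).
    apply: is_derive_eq; first exact: (@is_deriveV _ (@id R) t 1 1 tn0).
    by rewrite /= /GRing.scale /= mulr1.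
  have dk : is_derive t 1 (fun s => s ^- k) (- (k%:R * t ^- k.+1)).
    have -> : (fun s : R => s ^- k) = (fun s : R => s^-1) ^+ k.
      by apply/funext => s; rewrite fctE/= exprVn.
    apply: is_derive_eq.
    rewrite /GRing.scale /= -!exprVn mulrN; congr (- _).
    rewrite -mulr_natr; case: k {nt} => [|k]; first by rewrite mulr0 !mul0r.
    by rewrite /= !exprS; ring.
  have -> : (fun s : R => s ^- k * expR (- s^-1)) =
            (fun s : R => s ^- k) * (expR \o (- (fun s : R => s^-1))) by [].
  apply: is_derive_eq.
  rewrite !flat_gt0E// /GRing.scale /= -!exprVn !exprS !fctE. 
  by ring.
- have nt : \forall s \near t, cst 0 s = flat k s.
    by near=> s; rewrite flat_le0//= ltW//; near: s; exact: lt_nbhsl.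
  apply: (near_eq_is_derive nt).
  by apply: is_derive_eq; rewrite !flat_le0 ?ltW//; ring.
- have c0 : (e^-1 *: ((flat k \o shift 0) (e *: (1 : R)) - flat k 0))
               @[e --> (0 : R)^'] --> (0 : R).
    rewrite (_ : (fun e : R => _) = flat k.+1); last first.
      apply/funext => e; rewrite /= [flat k 0]flat_le0// subr0 addr0 /GRing.scale /= mulr1.
      have [->|e0] := eqVneq e 0; first by rewrite !flat_le0// mulr0.
      by rewrite -mul_flatS mulrA mulVf// mul1r.
    apply: cvg_within_filter.
    apply/norm_cvg0P.
    apply: (@squeeze_cvgr _ _ _ _ (fun=> 0) (fun e : R => k.+2`!%:R * `|e|)).
    - by near=> e; rewrite normr_ge0/= ger0_norm ?flat_ge0// flat_ub.
    - exact: cvg_cst.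
    - rewrite -[X in _ --> X](mulr0 k.+2`!%:R); apply: cvgMr.
      by rewrite -[X in _ --> X](@normr0 R R); apply: cvg_norm.
  rewrite !flat_le0// mulr0 subr0; apply: DeriveDef.
    by apply/cvg_ex; exists 0.
  exact: cvg_lim.
Unshelve. all: by end_near. Qed.

Fixpoint Cn1 n f : Prop :=
  if n is m.+1 then (forall t, derivable f t 1) /\ Cn1 m (derive1 f)
  else continuous f.

Lemma derivable_continuous f : (forall t, derivable f t 1) -> continuous f.
Proof. by move=> df t; apply/differentiable_continuous/derivable1_diffP. Qed.

Lemma Cn1_continuous n f : Cn1 n f -> continuous f.
Proof. by case: n => [//|n] [/derivable_continuous]. Qed.

Lemma Cn1_lin n f g c : Cn1 n f -> Cn1 n g -> Cn1 n (fun t => f t + c * g t).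
Proof.
elim: n f g => [|n IH] f g.
  by move=> cf cg t; apply: cvgD; [exact: cf|apply: cvgMr; exact: cg].
move=> [df cf] [dg cg].
have D t : is_derive t 1 (fun t => f t + c * g t) ((derive1 f) t + c * (derive1 g) t).
  have -> : (fun t => f t + c * g t) = f + c *: g by [].
  have ? : is_derive t 1 f ((derive1 f) t) by rewrite derive1E; apply: DeriveDef.
  have ? : is_derive t 1 g ((derive1 g) t) by rewrite derive1E; apply: DeriveDef.
  exact: is_deriveD.
split; first by move=> t; case: (D t).
have -> : (derive1 (fun t => f t + c * g t)) = (fun t => (derive1 f) t + c * (derive1 g) t).
  by apply/funext => t; rewrite derive1E; case: (D t).
exact: IH.
Qed.

Lemma derive1_flat k : (derive1 (flat k)) = (fun t => flat k.+2 t + (- k%:R) * flat k.+1 t).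
Proof.
apply/funext => t; rewrite derive1E mulNr.
by case: (is_derive_flat k t).
Qed.

Lemma Cn1_flat n k : Cn1 n (flat k).
Proof.
have df j t : derivable (flat j) t 1 by case: (is_derive_flat j t).
elim: n k => [|n IH] k; first exact: derivable_continuous.
by split=> //; rewrite derive1_flat; exact: Cn1_lin.
Qed.

End smooth.

(** * Smooth functions of two variables *)

Section smooth2.
Variable R : realType.
Implicit Types (p : R * R) (n : nat) (h k : R * R -> R).

Lemma Cn_continuous n h : Cn n h -> continuous h.
Proof. by case: n => [|n] []. Qed.

Lemma Cn_inv n h : Cn n.+1 h ->
  [/\ continuous h, forall p, derivable (fun s => h (s, p.2)) p.1 1,
      forall p, derivable (fun s => h (p.1, s)) p.2 1, Cn n (dx h) & Cn n (dy h)].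
Proof. by move=> [ch [Dx Dy cx cy]]; exact: (And5 ch Dx Dy cx cy). Qed.

Lemma CnS n h : Cn n.+1 h -> Cn n h.
Proof.
elim: n h => [|n IH] h; first by case.
move=> [ch [dx1 dy1 cx cy]].
exact: (conj ch (And4 dx1 dy1 (IH _ cx) (IH _ cy))).
Qed.

Lemma is_derive_dx h p : derivable (fun s => h (s, p.2)) p.1 1 ->
  is_derive p.1 1 (fun s => h (s, p.2)) (dx h p).
Proof. by move=> ?; rewrite /dx derive1E; apply: DeriveDef. Qed.

Lemma is_derive_dy h p : derivable (fun s => h (p.1, s)) p.2 1 ->
  is_derive p.2 1 (fun s => h (p.1, s)) (dy h p).
Proof. by move=> ?; rewrite /dy derive1E; apply: DeriveDef. Qed.

Lemma is_derive_dxE h p d : is_derive p.1 1 (fun s => h (s, p.2)) d -> dx h p = d.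
Proof. by rewrite /dx derive1E; case. Qed.

Lemma is_derive_dyE h p d : is_derive p.2 1 (fun s => h (p.1, s)) d -> dy h p = d.
Proof. by rewrite /dy derive1E; case. Qed.

(** Certifying regularity from formulas for the partial derivatives lets every closure property
    below go by induction on [n]. *)
Lemma Cn_build n h hx hy : continuous h ->
  (forall p, is_derive p.1 1 (fun s => h (s, p.2)) (hx p)) ->
  (forall p, is_derive p.2 1 (fun s => h (p.1, s)) (hy p)) ->
  Cn n hx -> Cn n hy -> Cn n.+1 h.
Proof.
move=> ch Hx Hy cx cy; split; first exact: ch.
split.
- by move=> p; case: (Hx p).
- by move=> p; case: (Hy p).
- suff -> : dx h = hx by [].
  by apply/funext => p; exact: is_derive_dxE.
- suff -> : dy h = hy by [].
  by apply/funext => p; exact: is_derive_dyE.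
Qed.

Lemma Cn_cst n c : @Cn R n (fun=> c).
Proof.
elim: n c => [|n IH] c; first by split=> //; exact: cst_continuous.
apply: (@Cn_build n _ (fun=> 0) (fun=> 0)) => //; first exact: cst_continuous.
- by move=> p; exact: is_derive_cst.
- by move=> p; exact: is_derive_cst.
Qed.

Lemma Cn_fst n : @Cn R n fst.
Proof.
have cf : continuous (fst : R * R -> R) by move=> p; exact: cvg_fst.
case: n => [|n] //.
apply: (Cn_build cf (fun p => is_derive_id p.1 1) (fun p => is_derive_cst p.1 p.2 1));
  exact: Cn_cst.
Qed.

Lemma Cn_snd n : @Cn R n snd.
Proof.
have cf : continuous (snd : R * R -> R) by move=> p; exact: cvg_snd.
case: n => [|n] //.
apply: (Cn_build cf (fun p => is_derive_cst p.2 p.1 1) (fun p => is_derive_id p.2 1));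
  exact: Cn_cst.
Qed.

Lemma CnD n h k : Cn n h -> Cn n k -> Cn n (fun p => h p + k p).
Proof.
elim: n h k => [|n IH] h k Ch Ck.
  by split=> // p; apply: cvgD; [apply: (Cn_continuous Ch)|apply: (Cn_continuous Ck)].
have [ch hx hy chx chy] := Cn_inv Ch; have [ck kx ky ckx cky] := Cn_inv Ck.
apply: (@Cn_build n _ (fun p => dx h p + dx k p) (fun p => dy h p + dy k p)).
- by move=> p; apply: cvgD; [apply: ch|apply: ck].
- by move=> p; apply: is_deriveD; exact: is_derive_dx.
- by move=> p; apply: is_deriveD; exact: is_derive_dy.
- exact: IH.
- exact: IH.
Qed.

Lemma is_derive_mul (f g : R -> R) (x a b : R) :
  is_derive x 1 f a -> is_derive x 1 g b ->
  is_derive x 1 (fun t => f t * g t) (f x * b + g x * a).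
Proof. by move=> df dg; exact: is_deriveM. Qed.

Lemma CnM n h k : Cn n h -> Cn n k -> Cn n (fun p => h p * k p).
Proof.
elim: n h k => [|n IH] h k Ch Ck.
  by split=> // p; apply: cvgM; [apply: (Cn_continuous Ch)|apply: (Cn_continuous Ck)].
have [ch hx hy chx chy] := Cn_inv Ch; have [ck kx ky ckx cky] := Cn_inv Ck.
apply: (@Cn_build n _ (fun p => h p * dx k p + k p * dx h p)
                      (fun p => h p * dy k p + k p * dy h p)).
- by move=> p; apply: cvgM; [apply: ch|apply: ck].
- move=> p; have := is_derive_mul (is_derive_dx (hx p)) (is_derive_dx (kx p)).
  by rewrite -surjective_pairing.
- move=> p; have := is_derive_mul (is_derive_dy (hy p)) (is_derive_dy (ky p)).
  by rewrite -surjective_pairing.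
- by apply: CnD; apply: IH => //; exact: CnS.
- by apply: CnD; apply: IH => //; exact: CnS.
Qed.

Lemma CnB n h k : Cn n h -> Cn n k -> Cn n (fun p => h p - k p).
Proof.
move=> Ch Ck.
rewrite (_ : (fun p => _) = fun p => h p + (fun=> -1) p * k p).
  by apply: CnD => //; apply: CnM => //; exact: Cn_cst.
by apply/funext => p; rewrite mulN1r.
Qed.

Lemma Cn_comp n (s : R -> R) h : Cn1 n s -> Cn n h -> Cn n (fun p => s (h p)).
Proof.
elim: n s h => [|n IH] s h Cs Ch.
  by split=> // p; apply: continuous_comp; [exact: (Cn_continuous Ch)|exact: Cs].
have [ch hx hy chx chy] := Cn_inv Ch; have [ds cs] : _ /\ Cn1 n (derive1 s) := Cs.
have D (t : R) : is_derive t 1 s (derive1 s t) by rewrite derive1E; exact: DeriveDef.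
apply: (@Cn_build n _ (fun p => derive1 s (h p) * dx h p)
                      (fun p => derive1 s (h p) * dy h p)).
- by move=> p; apply: continuous_comp; [exact: ch|exact: (Cn1_continuous Cs)].
- move=> p; apply: (@is_derive1_comp _ s (fun t => h (t, p.2))); last exact: is_derive_dx.
  by rewrite -surjective_pairing.
- move=> p; apply: (@is_derive1_comp _ s (fun t => h (p.1, t))); last exact: is_derive_dy.
  by rewrite -surjective_pairing.
- by apply: CnM => //; apply: IH => //; exact: CnS.
- by apply: CnM => //; apply: IH => //; exact: CnS.
Qed.

End smooth2.

(** * Test functions *)

Section test_functions.
Variable R : realType.
Implicit Types (p : R * R) (phi psi h : R * R -> R).

Lemma test_fun_continuous phi : test_fun phi -> continuous phi.
Proof. by move=> [C _ _]; exact: Cn_continuous (C 0%N). Qed.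

Lemma test_fun_out phi p : test_fun phi -> ~ Omega p -> phi p = 0.
Proof.
move=> [_ _ sub] np; apply/eqP/negP => /negP ph; apply: np; apply: sub.
exact: subset_closure.
Qed.

Lemma test_fun_dx phi : test_fun phi ->
  (forall p, is_derive p.1 1 (fun s => phi (s, p.2)) (dx phi p)) /\
  continuous (dx phi).
Proof.
move=> [C _ _]; have [_ d _ c _] := Cn_inv (C 1%N).
by split=> [p|]; [exact: is_derive_dx|exact: Cn_continuous c].
Qed.

Lemma test_fun_dy phi : test_fun phi ->
  (forall p, is_derive p.2 1 (fun s => phi (p.1, s)) (dy phi p)) /\
  continuous (dy phi).
Proof.
move=> [C _ _]; have [_ _ d _ c] := Cn_inv (C 1%N).
by split=> [p|]; [exact: is_derive_dy|exact: Cn_continuous c].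
Qed.

Let square (a b : R) : set (R * R) := `[a, b] `*` `[a, b].

Let compact_square (a b : R) : compact (square a b).
Proof. by apply: compact_setX; exact: segment_compact. Qed.

Lemma test_fun_build phi (e : R) : 0 < e -> (forall n, Cn n phi) ->
  (forall p, phi p != 0 -> (e <= p.1 <= 1 - e) /\ (e <= p.2 <= 1 - e)) ->
  test_fun phi.
Proof.
move=> e0 C H.
have clsq : closed (square e (1 - e)).
  apply: compact_closed; last exact: compact_square.
  exact: norm_hausdorff.
have sub : closure [set p | phi p != 0] `<=` square e (1 - e).
  rewrite [X in _ `<=` X](closure_id _).1//.
  by apply: closureS => p /= /H [p1 p2]; split; rewrite /= in_itv.
split=> //.
  by apply: (subclosed_compact _ (@compact_square e (1 - e)) sub); exact: closed_closure.
move=> p /sub [] /=; rewrite !in_itv/= /Omega/= => /andP[a b] /andP[c d].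
by split; lra.
Qed.

Lemma test_funM phi psi : test_fun phi -> (forall n, Cn n psi) ->
  test_fun (fun p => phi p * psi p).
Proof.
move=> [C cpt sub] D.
have cl : closure [set p | phi p * psi p != 0] `<=` closure [set p | phi p != 0].
  by apply: closureS => p /=; apply: contra_neq => ->; rewrite mul0r.
split.
- by move=> n; apply: CnM.
- by apply: (subclosed_compact _ cpt cl); exact: closed_closure.
- exact: subset_trans cl sub.
Qed.

Lemma test_funB phi psi : test_fun phi -> test_fun psi -> test_fun (phi \- psi).
Proof.
move=> [C cpt sub] [D cpt2 sub2].
have cl : closure [set p | (phi \- psi) p != 0] `<=`
          closure [set p | phi p != 0] `|` closure [set p | psi p != 0].
  rewrite -closureU; apply: closureS => p /=.
  have [->|] := eqVneq (phi p) 0; last by left.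
  by rewrite sub0r oppr_eq0; right.
split.
- by move=> n; apply: CnB.
- by apply: (subclosed_compact _ (compactU cpt cpt2) cl); exact: closed_closure.
- by apply: subset_trans cl _; rewrite subUset; split.
Qed.

Lemma continuous_bounded_Omega h : continuous h ->
  exists M, forall p, Omega p -> `|h p| <= M.
Proof.
move=> ch.
have /compact_bounded [M [_ HM]] : compact (h @` square 0 1).
  apply: continuous_compact; last exact: compact_square.
  exact: continuous_subspaceT.
exists (M + 1) => p [/andP[a b] /andP[c d]].
apply: (HM (M + 1)); first by rewrite ltrDl.
by exists p => //; split; rewrite /= in_itv/= !ltW.
Qed.

End test_functions.

(** * Square-integrable functions on a finite measure space *)

Section L2.
Context d (T : measurableType d) (R : realType).
Variables (mu : {measure set T -> \bar R}) (D : set T).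
Hypotheses (mD : measurable D) (fD : (mu D < +oo)%E).
Implicit Types (f g h : T -> R) (c M : R).

Definition L2 f := measurable_fun D f /\
  mu.-integrable D (fun x => (f x ^+ 2)%:E).

Notation Int f := (\int[mu]_(x in D) f x).
Notation intble f := (mu.-integrable D (EFin \o f)).

Lemma intble_dominated f g : measurable_fun D f ->
  (forall x, D x -> `|f x| <= g x) -> intble g -> intble f.
Proof.
move=> mf fg; apply: le_integrable => //; first exact/measurable_EFinP.
move=> x Dx /=; rewrite lee_fin (le_trans (fg x Dx))//.
exact: ler_norm.
Qed.

Lemma L2_sqr f : L2 f -> intble (fun x => f x ^+ 2).
Proof. by case. Qed.

Lemma intbleD f g : intble f -> intble g -> intble (fun x => f x + g x).
Proof. by move=> If Ig; have := integrableD mD If Ig; exact: eq_integrable. Qed.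

Lemma intbleZ c f : intble f -> intble (fun x => c * f x).
Proof. by move=> If; have := integrableZl mD c If; exact: eq_integrable. Qed.

Lemma L2_mul f g : L2 f -> L2 g -> intble (fun x => f x * g x).
Proof.
move=> [mf If] [mg Ig].
apply: (@intble_dominated _ (fun x => f x ^+ 2 + g x ^+ 2)).
- exact: measurable_funM.
- move=> x Dx; rewrite ler_norml; nra.
- exact: intbleD.
Qed.

Lemma L2_lin f g c : L2 f -> L2 g -> L2 (fun x => f x + c * g x).
Proof.
move=> Lf Lg; have [mf If] := Lf; have [mg Ig] := Lg.
split; first by apply: measurable_funD => //; exact: measurable_funM.
apply: (@intble_dominated (fun x => (f x + c * g x) ^+ 2)
  (fun x => 2 * f x ^+ 2 + (2 * c ^+ 2) * g x ^+ 2)).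
- apply: measurable_funX; apply: measurable_funD => //; exact: measurable_funM.
- by move=> x Dx; rewrite ger0_norm ?sqr_ge0//; have := sqr_ge0 (f x - c * g x); nra.
- by apply: intbleD; apply: intbleZ.
Qed.

Lemma L2_sub f g : L2 f -> L2 g -> L2 (fun x => f x - g x).
Proof.
move=> Lf Lg; have := L2_lin (-1) Lf Lg.
by under eq_fun do rewrite mulN1r.
Qed.

Lemma L2_bounded f M : measurable_fun D f -> (forall x, D x -> `|f x| <= M) -> L2 f.
Proof.
move=> mf fM; split => //.
apply: (@measurable_bounded_integrable _ _ _ mu (fun x => f x ^+ 2)) => //.
  exact: measurable_funX.
exists (M ^+ 2); split; first exact: num_real.
move=> y My x Dx; rewrite /= normrX (le_trans _ (ltW My))//.
by rewrite lerXn2r ?nnegrE ?fM// (le_trans _ (fM x Dx)).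
Qed.

Lemma L2_intble f : L2 f -> intble f.
Proof.
move=> Lf; have L1 : L2 (cst 1) by apply: (@L2_bounded _ 1) => // x; rewrite normr1.
by have := L2_mul Lf L1; apply: eq_integrable => // x _; rewrite /= mulr1.
Qed.

(** The quadratic polynomial [t] -> Int (f + t g)^2 is nonnegative; evaluating it at its minimum - B
    / C gives the inequality. *)
Lemma Cauchy_Schwarz f g : L2 f -> L2 g ->
  Int (fun x => f x * g x) ^+ 2 <= Int (fun x => f x ^+ 2) * Int (fun x => g x ^+ 2).
Proof.
move=> Lf Lg; set B := Int (fun x => f x * g x).
set A := Int (fun x => f x ^+ 2); set C := Int (fun x => g x ^+ 2).
have Ifg := L2_mul Lf Lg; have If := L2_sqr Lf; have Ig := L2_sqr Lg.
have H t : 0 <= A + (2 * t) * B + t ^+ 2 * C.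
  have -> : A + (2 * t) * B + t ^+ 2 * C = Int (fun x => (f x + t * g x) ^+ 2).
    have I1 := intbleZ (2 * t) Ifg; have I2 := intbleZ (t ^+ 2) Ig.
    have I3 := intbleD If I1.
    rewrite /A /B /C -!RintegralZl// -!RintegralD//.
    by apply: eq_Rintegral => x _; ring.
  by apply: Rintegral_ge0 => x _; exact: sqr_ge0.
have A0 : 0 <= A by apply: Rintegral_ge0 => x _; exact: sqr_ge0.
have C0 : 0 <= C by apply: Rintegral_ge0 => x _; exact: sqr_ge0.
have [C00|Cn0] := eqVneq C 0.
  have [->|Bn0] := eqVneq B 0; first by rewrite expr0n /= mulr_ge0.
  (* With C = 0 the polynomial is affine, and this [t] would give it the value -1 if B were
     nonzero. *)
  have := H (- (A + 1) / (2 * B)); rewrite C00 mulr0 addr0.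
  have -> : 2 * (- (A + 1) / (2 * B)) * B = - (A + 1) by field.
  by move=> ?; exfalso; lra.
have Cp : 0 < C by rewrite lt_neqAle eq_sym Cn0.
have := H (- B / C).
have -> : A + 2 * (- B / C) * B + (- B / C) ^+ 2 * C = (A * C - B ^+ 2) / C by field.
by rewrite ler_pdivlMr// mul0r subr_ge0.
Qed.

(** Strong convergence implies weak convergence, by Cauchy-Schwarz. The limits in the weak
    derivatives, in the energy and on the diagonal are all taken this way. *)
Lemma cvg_L2_mul (f_ : nat -> T -> R) f g : (forall n, L2 (f_ n)) -> L2 f -> L2 g ->
  Int (fun x => (f_ n x - f x) ^+ 2) @[n --> \oo] --> (0 : R) ->
  Int (fun x => f_ n x * g x) @[n --> \oo] --> Int (fun x => f x * g x).
Proof.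
move=> Lf_ Lf Lg cf.
have E n : Int (fun x => f_ n x * g x) - Int (fun x => f x * g x) =
    Int (fun x => (f_ n x - f x) * g x).
  rewrite -RintegralB//; [|exact: L2_mul..].
  by apply: eq_Rintegral => x _; rewrite mulrBl.
apply/subr_cvg0/norm_cvg0P.
have cs : Num.sqrt (Int (fun x => (f_ n x - f x) ^+ 2) * Int (fun x => g x ^+ 2))
    @[n --> \oo] --> (0 : R).
  rewrite -(sqrtr0 R); apply: continuous_cvg; first exact: sqrt_continuous.
  rewrite -(mul0r (Int (fun x => g x ^+ 2))); exact: cvgMl.
apply: (@squeeze_cvgr _ _ _ _ (fun=> 0) _ _ _ _ (cvg_cst 0) cs).
near=> n; rewrite normr_ge0/= E -sqrtr_sqr ler_sqrt ?mulr_ge0//.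
- by apply: Cauchy_Schwarz => //; exact: L2_sub.
- by apply: Rintegral_ge0 => x _; exact: sqr_ge0.
- by apply: Rintegral_ge0 => x _; exact: sqr_ge0.
Unshelve. all: by end_near. Qed.

Lemma cvg_bounded_Int (f_ : nat -> T -> R) f g M :
  (forall n, measurable_fun D (f_ n)) ->
  (forall n x, D x -> `|f_ n x| <= M) ->
  (forall x, D x -> f_ n x @[n --> \oo] --> f x) ->
  intble g ->
  Int (fun x => f_ n x * g x) @[n --> \oo] --> Int (fun x => f x * g x).
Proof.
move=> mf_ bf cf Ig.
have mg : measurable_fun D g by case/integrableP: Ig => /measurable_EFinP.
have mf : measurable_fun D f by apply: measurable_fun_cvg cf.
have fM x : D x -> `|f x| <= M.
  move=> Dx; apply: (cvgr_to_le (cvg_norm (cf x Dx))).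
  by near=> n; exact: bf.
have IM : mu.-integrable D (fun x => (M * `|g x|)%:E).
  by apply: intbleZ; exact: integrable_norm.
have [||||If _ H] := @dominated_convergence _ T R mu D mD
  (fun n x => (f_ n x * g x)%:E) (fun x => (f x * g x)%:E)
  (fun x => (M * `|g x|)%:E) _ _ _ IM _.
- by move=> n; apply/measurable_EFinP; exact: measurable_funM.
- by apply/measurable_EFinP; exact: measurable_funM.
- apply: aeW => x Dx; apply: cvg_EFin; first by near=> n.
  by apply: cvgMl; exact: cf.
- by apply: aeW => x n Dx; rewrite /= lee_fin normrM ler_wpM2r ?bf.
apply: fine_cvg; rewrite fineK//; exact: (integrable_fin_num mD If).
Unshelve. all: by end_near. Qed.

Lemma cvg_bounded_L2 (f_ : nat -> T -> R) f M :
  (forall n, measurable_fun D (f_ n)) ->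
  (forall n x, D x -> `|f_ n x| <= M) ->
  (forall x, D x -> f_ n x @[n --> \oo] --> f x) ->
  L2 f /\ Int (fun x => (f_ n x - f x) ^+ 2) @[n --> \oo] --> (0 : R).
Proof.
move=> mf_ bf cf.
have mf : measurable_fun D f by apply: measurable_fun_cvg cf.
have fM x : D x -> `|f x| <= M.
  move=> Dx; apply: (cvgr_to_le (cvg_norm (cf x Dx))).
  by near=> n; exact: bf.
split; first exact: L2_bounded fM.
have := @cvg_bounded_Int (fun n x => (f_ n x - f x) ^+ 2) (fun=> 0) (fun=> 1) ((2 * M) ^+ 2).
have -> : (fun n => Int (fun x => (f_ n x - f x) ^+ 2 * 1)) =
          (fun n => Int (fun x => (f_ n x - f x) ^+ 2)).
  by apply/funext => n; apply: eq_Rintegral => x _; rewrite mulr1.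
have -> : Int (fun=> 0 * 1) = 0 by rewrite mulr1 Rintegral_cst// mul0r.
apply.
- by move=> n; apply: measurable_funX; exact: measurable_funB.
- move=> n x Dx; rewrite normrX lerXn2r ?nnegrE//.
    by rewrite mulr_ge0// (le_trans _ (fM _ Dx)).
  by have := bf n x Dx; have := fM x Dx; have := ler_normB (f_ n x) (f x); lra.
- move=> x Dx; have /subr_cvg0 c0 := cf x Dx.
  under eq_fun do rewrite expr2.
  by rewrite -(mulr0 (0 : R)); exact: cvgM.
- by apply: L2_intble; apply: (@L2_bounded _ 1) => // x; rewrite normr1.
Unshelve. all: by end_near. Qed.

End L2.

(** * Completeness of L^2 *)

Lemma limn_einf_le (R : realType) (u : nat -> \bar R) (c : \bar R) :
  (forall n, (u n <= c)%E) -> (limn_einf u <= c)%E.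
Proof.
move=> uc; rewrite limn_einf_lim; apply: lime_le; first exact: is_cvg_einfs.
near=> n; apply: le_trans (uc n); apply: ereal_inf_lbound.
by exists n => /=.
Unshelve. all: by end_near. Qed.

Lemma cvg_of_nneseries_dist (R : realType) (f : nat -> R) :
  (\sum_(n <oo) `|f n.+1 - f n|%:E < +oo)%E -> cvgn f.
Proof.
move=> Soo; have /normed_cvg : cvgn [normed series (telescope f)].
  exact: (@nnseries_is_cvg _ (fun n => `|f n.+1 - f n|)).
rewrite telescopeK => c.
have -> : f = (fun n => (f n - f 0%N) + f 0%N).
  by apply/funext => n; rewrite subrK.
by apply: is_cvgD => //; exact: is_cvg_cst.
Qed.

Section L2_complete.
Context d (T : measurableType d) (R : realType).
Variables (mu : {measure set T -> \bar R}) (D : set T).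
Hypotheses (mD : measurable D) (fD : (mu D < +oo)%E).
Notation Int f := (\int[mu]_(x in D) f x).

(* Riesz-Fischer for a rapidly Cauchy sequence: the increments are summable in
   L1, so the sequence converges a.e., and Fatou's lemma identifies the limit. *)
Lemma L2_complete (f : nat -> T -> R) : (forall n, L2 mu D (f n)) ->
  (forall m n, (m <= n)%N -> Int (fun x => (f n x - f m x) ^+ 2) <= (4 ^- m)%R) ->
  exists2 g, L2 mu D g & Int (fun x => (f n x - g x) ^+ 2) @[n --> \oo] --> (0 : R).
Proof.
move=> Lf cau.
have mf n : measurable_fun D (f n) by case: (Lf n).
pose a n x := `|f n.+1 x - f n x|.
have ma n : measurable_fun D (a n).
  by apply: measurableT_comp => //; exact: measurable_funB.
pose C := (1 + fine (mu D)) / 2.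
have a0 n x : 0 <= a n x by exact: normr_ge0.
have C0 : 0 <= C by rewrite divr_ge0// addr_ge0// fine_ge0.
(* Integrate s <= 2^n s^2 / 2 + 2^-n / 2: since the squares integrate to at most 4^-n, the result is
   2^-n (1 + mu D) / 2 = 2^-n C. It is written as 2 C / 2^(n+1), the shape summed by
   [epsilon_trick0]. *)
have Ia n : (\int[mu]_(x in D) (a n x)%:E <= ((2 * C) / (2 ^ n.+1)%:R)%:E)%E.
  have La : L2 mu D (fun x => f n.+1 x - f n x) by exact: L2_sub.
  have Iia : mu.-integrable D (EFin \o a n).
    by apply: integrable_norm; exact: L2_intble La.
  rewrite -[leLHS]fineK ?(integrable_fin_num mD Iia)// lee_fin.
  change (Int (a n) <= 2 * C / (2 ^ n.+1)%:R).
  have I2 := L2_sqr La.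
  have Ic : mu.-integrable D (EFin \o (fun x : T => 1 : R)).
    by apply: (L2_intble mD fD); apply: (@L2_bounded _ _ _ _ _ mD fD _ 1) => // x; rewrite normr1.
  have J1 := intbleZ mD (2 ^+ n / 2) I2; have J2 := intbleZ mD (2 ^- n / 2) Ic.
  apply: (@le_trans _ _ (Int (fun x => (2 ^+ n / 2) * (f n.+1 x - f n x) ^+ 2 +
      (2 ^- n / 2) * 1))).
    apply: le_Rintegral => //; first exact: intbleD.
    move=> x Dx; rewrite /a; set t := _ - _.
    have p0 : 0 < 2 ^+ n :> R by rewrite exprn_gt0.
    rewrite -(real_normK (num_real t)); set s := `|t|.
    have -> : 2 ^+ n / 2 * s ^+ 2 + 2 ^- n / 2 * 1 =
      s + (2 ^+ n * s - 1) ^+ 2 / (2 * 2 ^+ n) by field; rewrite gt_eqF.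
    by rewrite lerDl divr_ge0 ?sqr_ge0// mulr_ge0// ltW.
  rewrite RintegralD// !RintegralZl// Rintegral_cst// mul1r.
  apply: (@le_trans _ _ (2 ^+ n / 2 * 4 ^- n + 2 ^- n / 2 * fine (mu D))).
    by rewrite lerD2r; apply: ler_wpM2l; [rewrite divr_ge0// exprn_ge0|exact: cau].
  rewrite le_eqVlt; apply/orP; left; apply/eqP.
  have -> : 4 ^+ n = 2 ^+ n * 2 ^+ n :> R by rewrite -exprMn; congr (_ ^+ _); ring.
  rewrite natrX exprS /C.
  by field; rewrite expf_eq0/= pnatr_eq0 andbF.
pose S x := (\sum_(n <oo) (a n x)%:E)%E.
have mS : measurable_fun D S.
  apply: (@ge0_emeasurable_sum _ _ _ D (fun n x => (a n x)%:E) xpredT).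
    by move=> k x _ _; rewrite lee_fin a0.
  by move=> k _; exact/measurable_EFinP.
have S0 x : (0 <= S x)%E by apply: nneseries_ge0 => n _ _; rewrite lee_fin a0.
have iS : mu.-integrable D S.
  apply/integrableP; split => //.
  under eq_integral do rewrite gee0_abs//.
  rewrite integral_nneseries//; last 2 first.
  - by move=> n; exact/measurable_EFinP.
  - by move=> n x _; rewrite lee_fin a0.
  apply: (@le_lt_trans _ _ (2 * C)%:E); last exact: ltry.
  apply: le_trans (@epsilon_trick0 R (2 * C) xpredT _); last by rewrite mulr_ge0.
  by apply: lee_nneseries => *; [apply: integral_ge0 => x _; rewrite lee_fin a0|exact: Ia].
have [N [mN N0 subN]] := integrable_ae mD iS.
pose E := D `\` N.
have mE : measurable E by exact: measurableD.
have ED : E `<=` D by move=> x [].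
have cE x : E x -> cvgn (f ^~ x).
  move=> [Dx Nx]; apply: cvg_of_nneseries_dist.
  have : S x \is a fin_num.
    by apply: contrapT => h; apply: Nx; apply: subN => /= /(_ Dx).
  by rewrite fin_num_abs gee0_abs.
(* The restricted sequence vanishes off [E], so it converges at every point of [D] and [g] is
   measurable as a pointwise limit. *)
pose g x := limn (fun n => (f n \_ E) x).
have pE x : E x -> (fun n => (f n \_ E) x) = f ^~ x.
  by move=> Ex; apply/funext => n; rewrite patchE mem_set.
have gE x : E x -> f n x @[n --> \oo] --> g x.
  by move=> Ex; rewrite /g pE//; exact: cE.
have mg : measurable_fun D g.
  apply: (@measurable_fun_cvg _ _ _ D (fun n => f n \_ E)).
    move=> n; apply: measurable_funTS; apply/(measurable_restrictT _ _).1 => //.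
    exact: measurable_funS (mf n).
  move=> x Dx; have [Ex|Ex] := pselect (E x); first by rewrite pE//; exact: gE.
  rewrite /g (_ : (fun n => (f n \_ E) x) = fun=> 0); first exact: is_cvg_cst.
  by apply/funext => n; rewrite patchE memNset.
have msq (h : T -> R) : measurable_fun D h -> measurable_fun D (fun x => (h x ^+ 2)%:E).
  by move=> mh; apply/measurable_EFinP; exact: measurable_funX.
have fatou_ m : (\int[mu]_(x in D) ((f m x - g x) ^+ 2)%:E <= (4 ^- m)%:E)%E.
  rewrite (ge0_negligible_integral mN)//; last 2 first.
  - by apply: msq; exact: measurable_funB.
  - by move=> x _; rewrite lee_fin sqr_ge0.
  rewrite -/E.
  pose h k x := ((f (m + k)%N x - f m x) ^+ 2)%:E.
  have mh k : measurable_fun D (h k) by apply: msq; exact: measurable_funB.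
  have h0 k x : (0 <= h k x)%E by rewrite lee_fin sqr_ge0.
  rewrite (_ : (\int[mu]_(x in E) _)%E = \int[mu]_(x in E) limn_einf (h ^~ x))%E; last first.
    apply: eq_integral => x /set_mem Ex; apply/esym.
    apply: (cvg_limn_einf_sup _).1; apply: cvg_EFin; first by near=> n.
    rewrite -sqrrN opprB expr2.
    have -> : fine \o h ^~ x = fun k => (f (m + k)%N x - f m x) * (f (m + k)%N x - f m x).
      by apply/funext => k; rewrite /h /= expr2.
    have c : f (m + n)%N x - f m x @[n --> \oo] --> g x - f m x.
      apply: cvgB; last exact: cvg_cst.
      rewrite (_ : (fun k => f (m + k)%N x) = [sequence (f ^~ x) (k + m)%N]_k).
        by rewrite (cvg_shiftn m (f ^~ x)); exact: gE.
      by apply/funext => k; rewrite /= addnC.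
    exact: cvgM.
  apply: le_trans (fatou _ _ _ _) _ => //.
    by move=> k; exact: measurable_funS (mh k).
  apply: limn_einf_le => k.
  apply: (@le_trans _ _ (\int[mu]_(x in D) h k x)%E).
    exact: ge0_subset_integral.
  have Lk := L2_sub mD (Lf (m + k)%N) (Lf m).
  rewrite -[leLHS]fineK; last exact: (integrable_fin_num mD (L2_sqr Lk)).
  by rewrite lee_fin; exact: cau (leq_addr _ _).
have Lfg m : L2 mu D (fun x => f m x - g x).
  split; first exact: measurable_funB.
  apply/integrableP; split; first by apply: msq; exact: measurable_funB.
  under eq_integral do rewrite gee0_abs ?lee_fin ?sqr_ge0//.
  exact: le_lt_trans (fatou_ m) (ltry _).
exists g.
  have := L2_sub mD (Lf 0%N) (Lfg 0%N).
  by congr L2; apply/funext => x; rewrite opprB addrC subrK.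
have c4 : (4 ^- n : R) @[n --> \oo] --> (0 : R).
  under eq_fun do rewrite -exprVn.
  by apply: cvg_expr; rewrite ger0_norm ?invr_ge0// invf_lt1// ltr1n.
apply: (@squeeze_cvgr _ _ _ _ (fun=> 0) _ _ _ _ (cvg_cst 0) c4).
near=> n; rewrite Rintegral_ge0/=; last by move=> x _; exact: sqr_ge0.
rewrite -lee_fin fineK; first exact: fatou_.
exact: (integrable_fin_num mD (L2_sqr (Lfg n))).
Unshelve. all: by end_near. Qed.

End L2_complete.

(** * Integration over the unit square *)

Section plane_measure.
Variable R : realType.
Notation plane := (measurableTypeR R * measurableTypeR R)%type.
Notation leb := (@lebesgue_measure R).
Notation leb2 := (leb \x leb)%E.
Implicit Types (h : R * R -> R) (M : R) (k : R -> R).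

(** The plane carries the product sigma-algebra, so open sets must be exhausted by countably many
    rectangles: all rational ones are indexed, and those not contained in [U] are replaced by the
    empty set. *)
Lemma open_plane_measurable (U : set (R * R)) : open U -> measurable (U : set plane).
Proof.
move=> oU.
pose rect (q : (rat * rat) * (rat * rat)) : set plane :=
  `]ratr q.1.1, ratr q.1.2[%classic `*` `]ratr q.2.1, ratr q.2.2[%classic.
have -> : U = \bigcup_q (if pselect (rect q `<=` U) then rect q else set0).
  apply/seteqP; split => [p Up|p [q _]]; last by case: pselect => // sub /sub.
  have /nbhs_ballP[e /= e0 be] : nbhs p U by exact: open_nbhs_nbhs.
  have ratbetween (x y : R) : x < y -> exists r : rat, x < ratr r < y.
    move=> xy; have [r] := rat_in_itvoo xy; rewrite in_itv /= => H.
    by exists r.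
  have [a1 /andP[a1l a1r]] := ratbetween (p.1 - e) p.1 ltac:(lra).
  have [b1 /andP[b1l b1r]] := ratbetween p.1 (p.1 + e) ltac:(lra).
  have [a2 /andP[a2l a2r]] := ratbetween (p.2 - e) p.2 ltac:(lra).
  have [b2 /andP[b2l b2r]] := ratbetween p.2 (p.2 + e) ltac:(lra).
  exists ((a1, b1), (a2, b2)) => //.
  case: pselect => [?|]; first by split; rewrite /= in_itv/=; apply/andP.
  case=> -[x y] [] /=; rewrite !in_itv/= => /andP[x1 x2] /andP[y1 y2].
  apply: be; split; rewrite /ball/= ltr_norml; lra.
apply: countable_bigcupT_measurable => [|q]; first exact: countableP.
by case: pselect => ? //=; apply: measurableX; exact: measurable_itv.
Qed.

Lemma continuous_measurable_plane h (D : set plane) : continuous h ->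
  measurable_fun D (h : plane -> measurableTypeR R).
Proof.
move=> ch; apply: measurable_funTS.
apply: (measurability _ (RGenOpens.measurableE R)) => // _ [_ [a [b ->]] <-].
by rewrite setTI; apply: open_plane_measurable; apply: open_comp => // *; exact: ch.
Qed.

Lemma OmegaE : @Omega R = `]0, 1[ `*` `]0, 1[.
Proof. by apply/seteqP; split => p; rewrite /Omega /= !in_itv. Qed.

Lemma measurable_Omega : measurable (@Omega R : set plane).
Proof. by rewrite OmegaE; exact: measurableX. Qed.

Lemma leb2_Omega : (leb2 (@Omega R : set plane) < +oo)%E.
Proof.
rewrite OmegaE product_measure1E//= !lebesgue_measure_itv/= !lte_fin ltr01.
by rewrite -EFinB -EFinM ltry.
Qed.

(** Fubini, applied to the extension of [h] by zero to the plane. Boundedness on a set of finite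
    measure supplies integrability, and the section integrals are expected in the closed form that
    the fundamental theorem of calculus yields. *)
Lemma int_Omega_sections_x h k M : measurable_fun (@Omega R : set plane) (h : plane -> R) ->
  (forall p, Omega p -> `|h p| <= M) ->
  (forall y, 0 < y < 1 -> (\int[leb]_(x in `]0%R, 1%R[) (h (x, y))%:E = (k y)%:E)%E) ->
  int_Omega h = \int[leb]_(y in `]0, 1[) k y.
Proof.
move=> mh hM hk.
have Ih : leb2.-integrable (@Omega R : set plane) (EFin \o h).
  have L := L2_bounded (mu := leb2) measurable_Omega leb2_Omega mh hM.
  exact (L2_intble measurable_Omega leb2_Omega L).
have := (@integrable_mkcond _ plane R leb2 _ (EFin \o h) measurable_Omega).1 Ih.
move=> /integral21_prod_meas1; rewrite -integral_mkcond => E.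
rewrite /int_Omega /Rintegral -E; congr fine.
rewrite [RHS]integral_mkcond; apply: eq_integral => y _.
rewrite /fubini_G patchE.
case: ifPn => [/set_mem /=|/negP yn].
  rewrite in_itv /= => y01; rewrite -hk// [RHS]integral_mkcond.
  apply: eq_integral => x _; rewrite !patchE; congr (if _ then _ else _).
  by apply/idP/idP => /set_mem H; apply/mem_set;
    move: H; rewrite OmegaE /= in_itv/= !in_itv/= y01 => //= -[].
apply: integral0_eq => x _; rewrite patchE memNset//.
by rewrite OmegaE => -[/= _ ?]; apply: yn; exact/mem_set.
Qed.

Lemma int_Omega_sections_y h k M : measurable_fun (@Omega R : set plane) (h : plane -> R) ->
  (forall p, Omega p -> `|h p| <= M) ->
  (forall x, 0 < x < 1 -> (\int[leb]_(y in `]0%R, 1%R[) (h (x, y))%:E = (k x)%:E)%E) ->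
  int_Omega h = \int[leb]_(x in `]0, 1[) k x.
Proof.
move=> mh hM hk.
have Ih : leb2.-integrable (@Omega R : set plane) (EFin \o h).
  have L := L2_bounded (mu := leb2) measurable_Omega leb2_Omega mh hM.
  exact (L2_intble measurable_Omega leb2_Omega L).
have := (@integrable_mkcond _ plane R leb2 _ (EFin \o h) measurable_Omega).1 Ih.
move=> /integral12_prod_meas1; rewrite -integral_mkcond => E.
rewrite /int_Omega /Rintegral -E; congr fine.
rewrite [RHS]integral_mkcond; apply: eq_integral => x _.
rewrite /fubini_F patchE.
case: ifPn => [/set_mem /=|/negP xn].
  rewrite in_itv /= => x01; rewrite -hk// [RHS]integral_mkcond.
  apply: eq_integral => y _; rewrite !patchE; congr (if _ then _ else _).
  by apply/idP/idP => /set_mem H; apply/mem_set;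
    move: H; rewrite OmegaE /= in_itv/= !in_itv/= x01 => //= -[].
apply: integral0_eq => y _; rewrite patchE memNset//.
by rewrite OmegaE => -[/= ? _]; apply: xn; exact/mem_set.
Qed.

Lemma FTC (F f : R -> R) (a b : R) : a < b ->
  (forall x : R, is_derive x 1 F (f x)) -> continuous f ->
  (\int[leb]_(x in `]a, b[) (f x)%:E = (F b - F a)%:E)%E.
Proof.
move=> ab dF cf.
have cF : continuous F by move=> x; apply/differentiable_continuous/derivable1_diffP; case: (dF x).
have mf (D : set R) : measurable_fun D (EFin \o f).
  by apply/measurable_EFinP; apply: measurable_funTS; exact: continuous_measurable_fun.
rewrite integral_itv_bndo_bndc// integral_itv_obnd_cbnd// EFinB.
apply: continuous_FTC2 => //.
- exact: continuous_subspaceT.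
- split.
  + by move=> x _; case: (dF x).
  + by apply: cvg_at_right_filter; exact: cF.
  + by apply: cvg_at_left_filter; exact: cF.
- by move=> x _; rewrite derive1E; case: (dF x).
Qed.

End plane_measure.

(** * The diagonal identity for test functions *)

Section green_identity.
Variable R : realType.
Notation plane := (measurableTypeR R * measurableTypeR R)%type.
Notation leb := (@lebesgue_measure R).
Notation leb2 := (leb \x leb)%E.
Implicit Types (phi h : R * R -> R) (p : R * R).

(** The large inequality here and the strict one in [Gy] fix the values on the diagonal so that both
    functions are exact pointwise limits of the smooth gradients on all of [Omega]. *)
Definition Gx p : R := (p.1 <= p.2)%R%:R - p.2.
Definition Gy p : R := (p.2 < p.1)%R%:R - p.1.

Lemma measurable_natr_bool d (T : measurableType d) (D : set T) (b : T -> bool) :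
  measurable_fun D b -> measurable_fun D (fun x => (b x)%:R : R).
Proof.
move=> mb mD; rewrite (_ : (fun x => _) = fun x => if b x then 1 else 0 : R).
  by apply: measurable_fun_if => //; exact: measurable_cst.
by apply/funext => x; case: (b x).
Qed.

Lemma measurable_Gx (D : set plane) : measurable_fun D (Gx : plane -> R).
Proof.
apply: measurable_funTS; apply: measurable_funB; last exact: measurable_snd.
apply: measurable_natr_bool; apply: measurable_fun_ler.
  exact: measurable_fst.
exact: measurable_snd.
Qed.

Lemma measurable_Gy (D : set plane) : measurable_fun D (Gy : plane -> R).
Proof.
apply: measurable_funTS; apply: measurable_funB; last exact: measurable_fst.
apply: measurable_natr_bool; apply: measurable_fun_ltr.
  exact: measurable_snd.
exact: measurable_fst.
Qed.

Lemma Gx_le1 p : Omega p -> `|Gx p| <= 1.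
Proof. by move=> [_ /andP[? ?]]; rewrite /Gx ler_norml; case: (p.1 <= p.2) => /=; lra. Qed.

Lemma Gy_le1 p : Omega p -> `|Gy p| <= 1.
Proof. by move=> [/andP[? ?] _]; rewrite /Gy ler_norml; case: (p.2 < p.1) => /=; lra. Qed.

(** The value of [h] at the break point [y] is left free, so that the lemma fits the diagonal
    conventions of both [Gx] and [Gy]. *)
Lemma FTC_piecewise (F f h : R -> R) (y a b : R) : 0 < y < 1 ->
  (forall x : R, is_derive x 1 F (f x)) -> continuous f ->
  measurable_fun setT h ->
  (forall x, x < y -> h x = a * f x) -> (forall x, y < x -> h x = b * f x) ->
  (\int[leb]_(x in `]0%R, 1%R[) (h x)%:E
    = (a * (F y - F 0) + b * (F 1 - F y))%:E)%E.
Proof.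
move=> /andP[y0 y1] dF cf mh ha hb.
have mhE (D : set R) : measurable_fun D (EFin \o h).
  by apply/measurable_EFinP; apply: measurable_funTS.
have -> : `]0, 1[%classic = `]0, y] `|` `]y, 1[.
  by rewrite -itv_bndbnd_setU// ?bnd_simp//= ltW.
have dis : [disjoint `]0, y] & `]y, 1[].
  rewrite disj_set2E; apply/eqP/seteqP; split => // x /= [].
  by rewrite !in_itv/=; lra.
rewrite integral_setU//; last by exact: mhE.
have D c (x : R) : is_derive x 1 (fun t => c * F t) (c * f x) by exact: is_deriveZ.
have C c : continuous (fun t => c * f t) by move=> t; apply: cvgMr; exact: cf.
rewrite -integral_itv_bndo_bndc//.
have -> : (\int[leb]_(x in `]0%R, y[) (h x)%:E = \int[leb]_(x in `]0%R, y[) (a * f x)%:E)%E.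
  by apply: eq_integral => x /set_mem; rewrite /= in_itv/= => /andP[_ xy]; rewrite ha.
have -> : (\int[leb]_(x in `]y, 1%R[) (h x)%:E = \int[leb]_(x in `]y, 1%R[) (b * f x)%:E)%E.
  by apply: eq_integral => x /set_mem; rewrite /= in_itv/= => /andP[xy _]; rewrite hb.
rewrite (FTC y0 (D a) (C a)) (FTC y1 (D b) (C b)) -EFinD.
by rewrite !mulrBr.
Qed.

Lemma test_fun_bounded_dx phi : test_fun phi ->
  exists M, forall p, Omega p -> `|dx phi p| <= M.
Proof. by move=> /test_fun_dx[_ c]; exact: continuous_bounded_Omega. Qed.

Lemma test_fun_bounded_dy phi : test_fun phi ->
  exists M, forall p, Omega p -> `|dy phi p| <= M.
Proof. by move=> /test_fun_dy[_ c]; exact: continuous_bounded_Omega. Qed.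

Lemma continuous_section_x h (y : R) : continuous h -> continuous (fun x => h (x, y)).
Proof.
move=> ch x; apply: (@continuous2_cvg _ _ _ _ _ _ id (cst y) (fun s t => h (s, t)) x y).
- by under eq_fun do rewrite -surjective_pairing; exact: ch.
- exact: cvg_id.
- exact: cvg_cst.
Qed.

Lemma continuous_section_y h (x : R) : continuous h -> continuous (fun y => h (x, y)).
Proof.
move=> ch y; apply: (@continuous2_cvg _ _ _ _ _ _ (cst x) id (fun s t => h (s, t)) x y).
- by under eq_fun do rewrite -surjective_pairing; exact: ch.
- exact: cvg_cst.
- exact: cvg_id.
Qed.

Lemma test_fun_boundary phi (t : R) : test_fun phi ->
  [/\ phi (0, t) = 0, phi (1, t) = 0, phi (t, 0) = 0 & phi (t, 1) = 0].
Proof. by move=> tp; split; apply: (test_fun_out tp); rewrite /Omega/= !ltxx ?andbF => -[]. Qed.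

(** On the section at height y, [Gx] equals 1 - y left of the diagonal and - y right of it; since
    [phi] vanishes at both ends, the section integral is (1 - y) phi (y, y) + y phi (y, y). *)
Lemma int_dx_Gx phi : test_fun phi ->
  int_Omega (fun p => dx phi p * Gx p) = \int[leb]_(t in `]0, 1[) phi (t, t).
Proof.
move=> tp; have [d c] := test_fun_dx tp; have [M HM] := test_fun_bounded_dx tp.
apply: (@int_Omega_sections_x _ _ (fun t => phi (t, t)) M).
- by apply: measurable_funM; [exact: continuous_measurable_plane|exact: measurable_Gx].
- by move=> p Op; rewrite normrM -(mulr1 M) ler_pM ?HM ?Gx_le1.
move=> y y01.
have dF (x : R) : is_derive x 1 (fun x => phi (x, y)) (dx phi (x, y)) by exact: (d (x, y)).
rewrite (FTC_piecewise (a := 1 - y) (b := - y) y01 dF).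
- by have [-> -> _ _] := test_fun_boundary y tp; congr EFin; ring.
- exact: continuous_section_x.
- apply: measurable_funM.
    by apply: continuous_measurable_fun; exact: continuous_section_x.
  apply: measurable_funB; last exact: measurable_cst.
  apply: measurable_natr_bool; apply: measurable_fun_ler.
    exact: measurable_id.
  exact: measurable_cst.
- by move=> x xy; rewrite /Gx/= ltW// mulrC.
- by move=> x xy; rewrite /Gx/= leNgt xy/= sub0r mulrC.
Qed.

Lemma int_dy_Gy phi : test_fun phi ->
  int_Omega (fun p => dy phi p * Gy p) = \int[leb]_(t in `]0, 1[) phi (t, t).
Proof.
move=> tp; have [d c] := test_fun_dy tp; have [M HM] := test_fun_bounded_dy tp.
apply: (@int_Omega_sections_y _ _ (fun t => phi (t, t)) M).
- by apply: measurable_funM; [exact: continuous_measurable_plane|exact: measurable_Gy].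
- by move=> p Op; rewrite normrM -(mulr1 M) ler_pM ?HM ?Gy_le1.
move=> x x01.
have dF (y : R) : is_derive y 1 (fun y => phi (x, y)) (dy phi (x, y)) by exact: (d (x, y)).
rewrite (FTC_piecewise (a := 1 - x) (b := - x) x01 dF).
- by have [_ _ -> ->] := test_fun_boundary x tp; congr EFin; ring.
- exact: continuous_section_y.
- apply: measurable_funM.
    by apply: continuous_measurable_fun; exact: continuous_section_y.
  apply: measurable_funB; last exact: measurable_cst.
  apply: measurable_natr_bool; apply: measurable_fun_ltr.
    exact: measurable_id.
  exact: measurable_cst.
- by move=> y xy; rewrite /Gy/= xy mulrC.
- by move=> y xy; rewrite /Gy/= ltNge ltW//= sub0r mulrC.
Qed.

(** Applied to a product of two test functions, this becomes integration by parts, so classical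
    derivatives of test functions are weak ones. *)
Lemma int_dx_test phi : test_fun phi -> int_Omega (dx phi) = 0.
Proof.
move=> tp; have [d c] := test_fun_dx tp; have [M HM] := test_fun_bounded_dx tp.
rewrite (@int_Omega_sections_x _ _ (fun t => 0) M) ?Rintegral_cst ?mul0r//.
- exact: continuous_measurable_plane.
- move=> y y01.
  have dF (x : R) : is_derive x 1 (fun x => phi (x, y)) (dx phi (x, y)) by exact: (d (x, y)).
  rewrite (FTC ltr01 dF).
  + by have [-> -> _ _] := test_fun_boundary y tp; rewrite subrr.
  + exact: continuous_section_x.
Qed.

Lemma int_dy_test phi : test_fun phi -> int_Omega (dy phi) = 0.
Proof.
move=> tp; have [d c] := test_fun_dy tp; have [M HM] := test_fun_bounded_dy tp.
rewrite (@int_Omega_sections_y _ _ (fun t => 0) M) ?Rintegral_cst ?mul0r//.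
- exact: continuous_measurable_plane.
- move=> x x01.
  have dF (y : R) : is_derive y 1 (fun y => phi (x, y)) (dy phi (x, y)) by exact: (d (x, y)).
  rewrite (FTC ltr01 dF).
  + by have [_ _ -> ->] := test_fun_boundary x tp; rewrite subrr.
  + exact: continuous_section_y.
Qed.

End green_identity.

(** * The fundamental lemma of the calculus of variations *)

(** Sets over which [f] integrates to zero form a Dynkin class, the total integral giving stability
    under complements; the pi-lambda theorem concludes. *)
Lemma integral_eq0_of_generator d (T : measurableType d) (R : realType)
    (mu : {measure set T -> \bar R}) (G : set (set T)) (f : T -> \bar R) :
  @measurable _ T = <<s G >> -> setI_closed G -> mu.-integrable setT f ->
  (\int[mu]_x f x = 0)%E -> (forall A, G A -> \int[mu]_(x in A) f x = 0)%E ->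
  forall A, measurable A -> (\int[mu]_(x in A) f x = 0)%E.
Proof.
move=> mG IG If fT fG A.
pose H : set (set T) := [set A | measurable A /\ (\int[mu]_(x in A) f x = 0)%E].
have dH : dynkin H.
  split.
  - by split => //.
  - move=> B [mB B0]; have mC := measurableC mB; split => //.
    have IB : mu.-integrable (B `|` ~` B) f by rewrite setUv.
    move: fT; rewrite -(setUv B) integral_setU//; last 2 first.
    + exact: measurable_int IB.
    + by rewrite disj_set2E setICr.
    by rewrite B0 add0e.
  - move=> F tF HF; have mF n : measurable (F n) by case: (HF n).
    split; first exact: bigcupT_measurable.
    rewrite integral_bigcup//; last by apply: integrableS If => //; exact: bigcupT_measurable.
    by apply: eseries0 => n _ _; case: (HF n).
rewrite mG -setI_closed_g_dynkin_g_sigma_algebra// => GA.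
have /(_ _ GA) [] : <<d G >> `<=` H; last by [].
apply: smallest_sub => // B GB; split; last exact: fG.
by rewrite mG; exact: sub_sigma_algebra.
Qed.

Section fundamental_lemma.
Variable R : realType.
Notation plane := (measurableTypeR R * measurableTypeR R)%type.
Notation leb := (@lebesgue_measure R).
Notation leb2 := (leb \x leb)%E.
Implicit Types (phi g h : R * R -> R) (p : R * R) (a c t : R).

(** Quadrants form a generating pi-system whose indicators split into products of one-variable
    steps, each of which is a limit of smooth functions. *)
Definition quadrant a c : set (R * R) := `]a, +oo[ `*` `]c, +oo[.

Definition quadrants : set (set (R * R)) :=
  [set A | exists a c, A = quadrant a c].

Lemma quadrants_setI_closed : setI_closed quadrants.
Proof.
move=> _ _ [a [c ->]] [a' [c' ->]]; exists (Num.max a a'), (Num.max c c').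
apply/seteqP; split => p; rewrite /quadrant /= !in_itv/= !andbT !gt_max.
  by move=> [[-> ->] [-> ->]].
by move=> [/andP[-> ->] /andP[-> ->]].
Qed.

Lemma measurable_quadrant a c : measurable (quadrant a c : set plane).
Proof. by apply: measurableX; exact: measurable_itv. Qed.

(** A half-plane is the union of the quadrants whose other corner coordinate is - n, so both
    projections are measurable for the sigma-algebra generated by quadrants. *)
Lemma measurable_planeE : @measurable _ plane = <<s quadrants >>.
Proof.
apply/seteqP; split; last first.
  apply: smallest_sub; first exact: sigma_algebra_measurable.
  by move=> _ [a [c ->]]; exact: measurable_quadrant.
pose X := g_sigma_algebraType quadrants.
have ray (t : R) : exists n : nat, - n%:R < t.
  exists (Num.truncn `|t|).+1; rewrite ltrNl (le_lt_trans (ler_norm _))// normrN.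
  exact: truncnS_gt.
have mfst : measurable_fun setT (fst : X -> measurableTypeR R).
  apply: (measurability _ (RGenOInfty.measurableE R)) => // _ [_ [a ->] <-].
  rewrite setTI (_ : _ @^-1` _ = \bigcup_n quadrant a (- n%:R)).
    apply: (@bigcupT_measurable _ X) => n; apply: sub_sigma_algebra.
    by exists a, (- n%:R).
  apply/seteqP; split => p /=; rewrite /quadrant/=.
    move=> ap; have [n pn] := ray p.2; exists n => //=.
    by split=> //; rewrite in_itv/= pn.
  by move=> [n _ []].
have msnd : measurable_fun setT (snd : X -> measurableTypeR R).
  apply: (measurability _ (RGenOInfty.measurableE R)) => // _ [_ [c ->] <-].
  rewrite setTI (_ : _ @^-1` _ = \bigcup_n quadrant (- n%:R) c).
    apply: (@bigcupT_measurable _ X) => n; apply: sub_sigma_algebra.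
    by exists (- n%:R), c.
  apply/seteqP; split => p /=; rewrite /quadrant/=.
    move=> ap; have [n pn] := ray p.1; exists n => //=.
    by split=> //; rewrite in_itv/= pn.
  by move=> [n _ []].
rewrite measurable_prod_measurableType.
apply: smallest_sub; first exact: smallest_sigma_algebra.
move=> _ [A mA [B mB <-]].
have -> : A `*` B = (fst @^-1` A) `&` (snd @^-1` B) by [].
apply: (@measurableI _ X).
  by rewrite -[X in measurable X]setTI; exact: mfst.
by rewrite -[X in measurable X]setTI; exact: msnd.
Qed.

End fundamental_lemma.

(** * Limits of rescaled flat functions and smooth steps *)

Section flat_limits.
Variable R : realType.
Implicit Types (t l c : R) (u : nat -> R) (n : nat).

Lemma flat0_le1 t : flat 0 t <= 1.
Proof.
have [t0|t0] := ltP 0 t; last by rewrite flat_le0.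
by rewrite flat_gt0E// expr0 invr1 mul1r expR_le1 oppr_le0 invr_ge0 ltW.
Qed.

Lemma flat0_ge t : 0 < t -> 1 - t^-1 <= flat 0 t.
Proof. by move=> t0; rewrite flat_gt0E// expr0 invr1 mul1r; exact: expR_ge1Dx. Qed.

Lemma flat1_le t : 0 < t -> flat 1 t <= t^-1.
Proof.
move=> t0; rewrite flat_gt0E// expr1; have ti : 0 <= t^-1 by rewrite invr_ge0 ltW.
by apply: ler_piMr => //; rewrite expR_le1 oppr_le0.
Qed.

(* [(1 + s) exp (- s) <= 1] with [s = 1 / t] *)
Lemma flat01_le1 t : flat 0 t + flat 1 t <= 1.
Proof.
have [t0|t0] := ltP 0 t; last by rewrite !flat_le0// addr0.
rewrite !flat_gt0E// expr0 invr1 expr1 -mulrDl expRN ler_pdivrMr ?expR_gt0// mul1r.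
exact: expR_ge1Dx.
Qed.

Lemma cvg_inv_scaled u l : u n @[n --> \oo] --> l -> 0 < l ->
  (n.+1%:R * u n)^-1 @[n --> \oo] --> (0 : R).
Proof.
move=> ul l0.
have -> : (fun n => (n.+1%:R * u n)^-1) = (fun n => harmonic n * (u n)^-1).
  by apply/funext => n; rewrite /harmonic invfM.
rewrite -(mul0r l^-1); apply: cvgM; first exact: cvg_harmonic.
by apply: cvgV => //; rewrite gt_eqF.
Qed.

Lemma near_scaled_gt0 u l : u n @[n --> \oo] --> l -> 0 < l ->
  \forall n \near \oo, 0 < n.+1%:R * u n.
Proof.
move=> ul l0; near=> n; rewrite mulr_gt0//; near: n.
exact: (cvgr_gt l ul).
Unshelve. all: by end_near. Qed.

Lemma cvg_flat0 u l : u n @[n --> \oo] --> l -> 0 < l ->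
  flat 0 (n.+1%:R * u n) @[n --> \oo] --> (1 : R).
Proof.
move=> ul l0.
apply: (@squeeze_cvgr _ _ _ _ (fun n => 1 - (n.+1%:R * u n)^-1) (fun=> 1)).
- near=> n; rewrite flat0_le1 flat0_ge//; near: n; exact: near_scaled_gt0 ul l0.
- rewrite -[X in _ --> X]subr0; apply: cvgB; first exact: cvg_cst.
  exact: cvg_inv_scaled ul l0.
- exact: cvg_cst.
Unshelve. all: by end_near. Qed.

Lemma cvg_flat1 u l : u n @[n --> \oo] --> l -> 0 < l ->
  flat 1 (n.+1%:R * u n) @[n --> \oo] --> (0 : R).
Proof.
move=> ul l0.
apply: (@squeeze_cvgr _ _ _ _ (fun=> 0) (fun n => (n.+1%:R * u n)^-1)).
- near=> n; rewrite flat_ge0 flat1_le//; near: n; exact: near_scaled_gt0 ul l0.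
- exact: cvg_cst.
- exact: cvg_inv_scaled ul l0.
Unshelve. all: by end_near. Qed.

(** A smooth approximation of the indicator of t > 0. The factor n + 1 sharpens the step, and the
    shift by 1 / (n + 1) keeps the support away from 0, which later makes supports compact in the
    open square. *)
Definition step n t := flat 0 (n.+1%:R * (t - n.+1%:R^-1)).

Lemma step_bounds n t : 0 <= step n t <= 1.
Proof. by rewrite flat_ge0 flat0_le1. Qed.

Lemma step_gt n t : step n t != 0 -> n.+1%:R^-1 <= t.
Proof.
rewrite leNgt; apply: contraNN => tn; rewrite /step flat_le0//.
by rewrite pmulr_rle0// subr_le0 ltW.
Qed.

Lemma cvg_step t : step n t @[n --> \oo] --> ((0 < t)%R%:R : R).
Proof.
have [t0|t0] := ltP 0 t.
  apply: (@cvg_flat0 (fun n => t - n.+1%:R^-1) t) => //.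
  rewrite -[X in _ --> X]subr0; apply: cvgB; first exact: cvg_cst.
  exact: cvg_harmonic.
rewrite (_ : (fun n => step n t) = fun=> 0); first exact: cvg_cst.
apply/funext => n; rewrite /step flat_le0// pmulr_rle0// subr_le0.
by rewrite (le_trans t0)// invr_ge0.
Qed.

Lemma Cn_step (k : nat) n (h : R * R -> R) : Cn k h -> Cn k (fun p => step n (h p)).
Proof.
move=> Ch; apply: (@Cn_comp _ k (flat 0) (fun p => n.+1%:R * (h p - n.+1%:R^-1))).
  exact: Cn1_flat.
apply: CnM; first exact: Cn_cst.
by apply: CnB => //; exact: Cn_cst.
Qed.

End flat_limits.

(** * Smooth bumps and functions orthogonal to all test functions *)

Section fundamental_lemma2.
Variable R : realType.
Notation plane := (measurableTypeR R * measurableTypeR R)%type.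
Notation leb := (@lebesgue_measure R).
Notation leb2 := (leb \x leb)%E.
Implicit Types (phi g h : R * R -> R) (p : R * R) (a c t : R) (n : nat).

(** Approximates the indicator of t > a inside the unit interval; the maximum with 0 keeps the
    support inside it when [a] is negative. *)
Definition bump n a t : R := step n (t - Num.max a 0) * step n (1 - t).

Lemma bump_bounds n a t : 0 <= bump n a t <= 1.
Proof.
rewrite /bump; have /andP[x0 x1] := step_bounds n (t - Num.max a 0).
have /andP[y0 y1] := step_bounds n (1 - t).
by rewrite mulr_ge0//= mulr_ile1.
Qed.

Lemma bump_supp n a t : bump n a t != 0 -> n.+1%:R^-1 <= t <= 1 - n.+1%:R^-1.
Proof.
rewrite mulf_eq0 negb_or => /andP[/step_gt + /step_gt].
have : 0 <= Num.max a 0 by rewrite le_max lexx orbT.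
by move: (Num.max a 0) (n.+1%:R^-1) => m e m0 ta t1; lra.
Qed.

Lemma cvg_bump a t : 0 < t < 1 -> bump n a t @[n --> \oo] --> ((a < t)%R%:R : R).
Proof.
move=> /andP[t0 t1].
rewrite (_ : (a < t)%R%:R = (0 < t - Num.max a 0)%R%:R * (0 < 1 - t)%R%:R).
  by apply: cvgM; exact: cvg_step.
by rewrite !subr_gt0 t1 mulr1 gt_max t0 andbT.
Qed.

Definition bump2 n a c p : R := bump n a p.1 * bump n c p.2.

Lemma bump2_le1 n a c p : `|bump2 n a c p| <= 1.
Proof.
have /andP[x0 x1] := bump_bounds n a p.1; have /andP[y0 y1] := bump_bounds n c p.2.
rewrite /bump2 normrM !ger0_norm//; exact: mulr_ile1.
Qed.

Lemma test_fun_bump2 n a c : test_fun (bump2 n a c).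
Proof.
apply: (@test_fun_build _ _ n.+1%:R^-1); first by rewrite invr_gt0.
  move=> k; apply: CnM; apply: CnM; apply: Cn_step; apply: CnB;
    by [exact: Cn_fst|exact: Cn_snd|exact: Cn_cst].
by move=> p; rewrite mulf_eq0 negb_or => /andP[/bump_supp ? /bump_supp].
Qed.

Lemma cvg_bump2 a c p : Omega p ->
  bump2 n a c p @[n --> \oo] --> (\1_(quadrant a c) p : R).
Proof.
move=> [p1 p2].
rewrite indicE (_ : (p \in _) = (a < p.1) && (c < p.2)); last first.
  by apply/idP/idP => [/set_mem|H]; [|apply/mem_set]; rewrite /quadrant/= !in_itv/= !andbT;
    [move=> [-> ->]|apply/andP].
rewrite -mulnb natrM.
by apply: cvgM; exact: cvg_bump.
Qed.

(** Testing with [bump2] and letting [n] grow shows, by dominated convergence, that [g] has zero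
    integral over the part of [Omega] in each quadrant; the generator lemma extends this to all
    measurable sets. *)
Lemma weak_zero_ae g : L2_Omega g ->
  (forall phi, test_fun phi -> int_Omega (fun p => g p * phi p) = 0) ->
  ae_eq leb2 (@Omega R : set plane) (EFin \o g) (cst 0%E).
Proof.
move=> Lg g0.
have mO := @measurable_Omega R; have fO := @leb2_Omega R.
have Ig : leb2.-integrable (@Omega R : set plane) (EFin \o (g : plane -> R)).
  exact (L2_intble mO fO Lg).
pose f : plane -> \bar R := (EFin \o g) \_ (@Omega R).
have If : leb2.-integrable setT f by exact: (integrable_mkcond _ mO).1 Ig.
have fE (A : set plane) : measurable A ->
    (\int[leb2]_(p in A) f p = (\int[leb2]_(p in (@Omega R : set plane)) (\1_A p * g p))%:E)%E.
  move=> mA; rewrite -integral_mkcondr setIC integral_mkcondr /Rintegral fineK.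
    apply: eq_integral => p _; rewrite patchE /= indicE.
    by case: ifPn => _; rewrite ?mul1r ?mul0r.
  apply: (integrable_fin_num mO).
  apply: (@intble_dominated _ _ _ leb2 _ mO _ (fun p : plane => `|g p|)).
  - by apply: measurable_funM; [exact: measurable_indic|case: Lg].
  - by move=> p _; rewrite normrM indicE; case: (_ \in _); rewrite ?normr1 ?normr0 ?mul1r ?mul0r.
  - exact: integrable_norm.
have fQ a c : (\int[leb2]_(p in (quadrant a c : set plane)) f p = 0)%E.
  rewrite fE; last exact: measurable_quadrant.
  have := @cvg_bounded_Int _ plane R leb2 _ mO (fun n => bump2 n a c)
    (\1_(quadrant a c)) g 1 _ _ _ Ig.
  rewrite (_ : (fun n => _) = fun=> 0); last first.
    apply/funext => n; rewrite -[RHS](g0 _ (test_fun_bump2 n a c)).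
    by apply: eq_Rintegral => p _; rewrite mulrC.
  move=> H; congr EFin; apply/esym; move: H => /(_ _ _ _)/cvg_lim <- //; first by rewrite lim_cst.
  - by move=> n; apply: continuous_measurable_plane;
      exact: test_fun_continuous (test_fun_bump2 n a c).
  - by move=> n p _; exact: bump2_le1.
  - by move=> p; exact: cvg_bump2.
(* A quadrant containing [Omega] provides the vanishing total integral that the generator lemma asks
   for. *)
have OQ : (@Omega R : set plane) `<=` quadrant (-1) (-1).
  by move=> p [/andP[? _] /andP[? _]]; split; rewrite /= in_itv/= andbT; lra.
apply: integral_ae_eq => //.
move=> E EO mE; rewrite integral0.
have <- : (\int[leb2]_(p in E) f p = \int[leb2]_(x in E) (EFin \o g) x)%E.
  by apply: eq_integral => p /set_mem Ep; rewrite /f patchE mem_set//; exact: EO.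
apply: (integral_eq0_of_generator (@measurable_planeE R) (@quadrants_setI_closed R) If) => //.
- rewrite -(fQ (-1) (-1)) [RHS]integral_mkcond; apply: eq_integral => p _.
  rewrite patchE; case: ifPn => // pQ; rewrite /f patchE; case: ifPn => // /set_mem /OQ.
  by move/mem_set; rewrite (negbTE pQ).
- by move=> _ [a [c ->]].
Qed.

End fundamental_lemma2.

(** * Weak derivatives *)

Section weak_derivatives.
Variable R : realType.
Notation plane := (measurableTypeR R * measurableTypeR R)%type.
Notation leb := (@lebesgue_measure R).
Notation leb2 := (leb \x leb)%E.
Notation OO := (@Omega R : set plane).
Implicit Types (phi psi g u v h : R * R -> R) (p : R * R).
Implicit Types d : (R * R -> R) -> R * R -> R.

Let mO : measurable OO := @measurable_Omega R.
Let fO : (leb2 OO < +oo)%E := @leb2_Omega R.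

Lemma continuous_L2_Omega h : continuous h -> L2_Omega h.
Proof.
move=> ch; have [M HM] := continuous_bounded_Omega ch.
apply: (@L2_bounded _ plane R leb2 _ mO fO _ M) => //.
exact: continuous_measurable_plane.
Qed.

Lemma test_fun_L2 phi : test_fun phi -> L2_Omega phi.
Proof. by move=> /test_fun_continuous; exact: continuous_L2_Omega. Qed.

Lemma dx_L2 phi : test_fun phi -> L2_Omega (dx phi).
Proof. by move=> /test_fun_dx[_]; exact: continuous_L2_Omega. Qed.

Lemma dy_L2 phi : test_fun phi -> L2_Omega (dy phi).
Proof. by move=> /test_fun_dy[_]; exact: continuous_L2_Omega. Qed.

Lemma L2_Omega_sub u v : L2_Omega u -> L2_Omega v -> L2_Omega (u \- v).
Proof. exact: (@L2_sub _ plane R leb2 _ mO). Qed.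

Lemma L2_Omega_mul u v : L2_Omega u -> L2_Omega v ->
  leb2.-integrable OO (EFin \o (fun p : plane => u p * v p)).
Proof. exact: (@L2_mul _ plane R leb2 _ mO). Qed.

Lemma L2_Omega_sqr u : L2_Omega u ->
  leb2.-integrable OO (EFin \o (fun p : plane => u p ^+ 2)).
Proof. by case. Qed.

Lemma int_OmegaD u v : leb2.-integrable OO (EFin \o (u : plane -> R)) ->
  leb2.-integrable OO (EFin \o (v : plane -> R)) ->
  int_Omega (fun p => u p + v p) = int_Omega u + int_Omega v.
Proof. exact: RintegralD. Qed.

Lemma int_OmegaB u v : leb2.-integrable OO (EFin \o (u : plane -> R)) ->
  leb2.-integrable OO (EFin \o (v : plane -> R)) ->
  int_Omega (fun p => u p - v p) = int_Omega u - int_Omega v.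
Proof. exact: RintegralB. Qed.

Lemma eq_int_Omega u v : (forall p, u p = v p) -> int_Omega u = int_Omega v.
Proof. by move=> uv; congr int_Omega; exact/funext. Qed.

Lemma is_weak_deriv_sub d u v g h : (forall phi, test_fun phi -> L2_Omega (d phi)) ->
  L2_Omega u -> L2_Omega v -> is_weak_deriv d u g -> is_weak_deriv d v h ->
  is_weak_deriv d (u \- v) (g \- h).
Proof.
move=> dL Lu Lv [Lg Hg] [Lh Hh]; split; first exact: L2_Omega_sub.
move=> phi tphi; have Ld := dL _ tphi; have Lp := test_fun_L2 tphi.
rewrite (_ : int_Omega (fun p => (u \- v) p * d phi p) =
  int_Omega (fun p => u p * d phi p) - int_Omega (fun p => v p * d phi p)); last first.
  rewrite -int_OmegaB; [|exact: L2_Omega_mul..].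
  by apply: eq_int_Omega => p /=; rewrite mulrBl.
rewrite (_ : int_Omega (fun p => (g \- h) p * phi p) =
  int_Omega (fun p => g p * phi p) - int_Omega (fun p => h p * phi p)); last first.
  rewrite -int_OmegaB; [|exact: L2_Omega_mul..].
  by apply: eq_int_Omega => p /=; rewrite mulrBl.
by rewrite Hg// Hh// opprB opprK addrC.
Qed.

Lemma is_weak_deriv_uniq d u g h : is_weak_deriv d u g -> is_weak_deriv d u h ->
  ae_eq leb2 OO (EFin \o g) (EFin \o h).
Proof.
move=> [Lg Hg] [Lh Hh].
have : ae_eq leb2 OO (EFin \o (g \- h)) (cst 0%E).
  apply: weak_zero_ae; first exact: L2_Omega_sub.
  move=> phi tphi; have Lp := test_fun_L2 tphi.
  have -> : int_Omega (fun p => (g \- h) p * phi p) =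
      int_Omega (fun p => g p * phi p) - int_Omega (fun p => h p * phi p).
    rewrite -int_OmegaB; [|exact: L2_Omega_mul..].
    by apply: eq_int_Omega => p /=; rewrite mulrBl.
  by apply/eqP; rewrite subr_eq0 -eqr_opp -Hg// -Hh.
apply: filterS => p H Op; have := H Op => /= -[/eqP].
by rewrite subr_eq0 => /eqP ->.
Qed.

Lemma weak_derivP d u g : is_weak_deriv d u g -> is_weak_deriv d u (weak_deriv d u).
Proof. by move=> ug; rewrite /weak_deriv; apply: (xgetI (cst 0) ug). Qed.

Lemma ae_int_Omega u v : measurable_fun OO (u : plane -> R) ->
  measurable_fun OO (v : plane -> R) ->
  ae_eq leb2 OO (EFin \o u) (EFin \o v) -> int_Omega u = int_Omega v.
Proof.
move=> mu mv uv; congr fine; apply: ae_eq_integral => //; exact/measurable_EFinP.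
Qed.

Lemma int_weak_deriv_mul d u v g h : is_weak_deriv d u g -> is_weak_deriv d v h ->
  int_Omega (fun p => weak_deriv d u p * weak_deriv d v p) =
  int_Omega (fun p => g p * h p).
Proof.
move=> ug vh; have ug' := weak_derivP ug; have vh' := weak_derivP vh.
apply: ae_int_Omega.
- by apply: measurable_funM; [case: ug' => -[]|case: vh' => -[]].
- by apply: measurable_funM; [case: ug => -[]|case: vh => -[]].
have := is_weak_deriv_uniq vh' vh; have := is_weak_deriv_uniq ug' ug.
apply: filterS2 => p H1 H2 Op.
by have [E1] := H1 Op; have [E2] := H2 Op; rewrite /= E1 E2.
Qed.

Lemma int_grad_dot u v gx gy hx hy :
  is_weak_deriv (@dx R) u gx -> is_weak_deriv (@dy R) u gy ->
  is_weak_deriv (@dx R) v hx -> is_weak_deriv (@dy R) v hy ->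
  int_Omega (grad_dot u v) =
    int_Omega (fun p => gx p * hx p) + int_Omega (fun p => gy p * hy p).
Proof.
move=> ux uy vx vy; rewrite -(int_weak_deriv_mul ux vx) -(int_weak_deriv_mul uy vy).
have [Lux _] := weak_derivP ux; have [Luy _] := weak_derivP uy.
have [Lvx _] := weak_derivP vx; have [Lvy _] := weak_derivP vy.
by rewrite -int_OmegaD; [|exact: L2_Omega_mul..].
Qed.

Lemma grad_dot_integrable u v gx gy hx hy :
  is_weak_deriv (@dx R) u gx -> is_weak_deriv (@dy R) u gy ->
  is_weak_deriv (@dx R) v hx -> is_weak_deriv (@dy R) v hy ->
  leb2.-integrable OO (EFin \o (grad_dot u v : plane -> R)).
Proof.
move=> ux uy vx vy.
have [Lux _] := weak_derivP ux; have [Luy _] := weak_derivP uy.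
have [Lvx _] := weak_derivP vx; have [Lvy _] := weak_derivP vy.
by apply: (intbleD mO); exact: L2_Omega_mul.
Qed.

Lemma H1_normE u gx gy : L2_Omega u ->
  is_weak_deriv (@dx R) u gx -> is_weak_deriv (@dy R) u gy ->
  H1_norm u = Num.sqrt (int_Omega (fun p => u p ^+ 2) +
    (int_Omega (fun p => gx p ^+ 2) + int_Omega (fun p => gy p ^+ 2))).
Proof.
move=> Lu ux uy; rewrite /H1_norm int_OmegaD.
- by rewrite (int_grad_dot ux uy ux uy).
- exact: L2_Omega_sqr.
- exact: (grad_dot_integrable ux uy ux uy).
Qed.

Lemma test_fun_weak_dx phi : test_fun phi -> is_weak_deriv (@dx R) phi (dx phi).
Proof.
move=> tphi; split; first exact: dx_L2.
move=> psi tpsi; have := int_dx_test (test_funM tphi (let: And3 c _ _ := tpsi in c)).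
have [d1 _] := test_fun_dx tphi; have [d2 _] := test_fun_dx tpsi.
rewrite (_ : dx (fun p => phi p * psi p) = fun p => phi p * dx psi p + dx phi p * psi p).
  rewrite int_OmegaD; first by move/eqP; rewrite addr_eq0 => /eqP.
    by apply: L2_Omega_mul; [exact: test_fun_L2|exact: dx_L2].
  by apply: L2_Omega_mul; [exact: dx_L2|exact: test_fun_L2].
apply/funext => p; apply: is_derive_dxE.
have := is_derive_mul (d1 p) (d2 p); rewrite -surjective_pairing.
by rewrite (mulrC (dx phi p)).
Qed.

Lemma test_fun_weak_dy phi : test_fun phi -> is_weak_deriv (@dy R) phi (dy phi).
Proof.
move=> tphi; split; first exact: dy_L2.
move=> psi tpsi; have := int_dy_test (test_funM tphi (let: And3 c _ _ := tpsi in c)).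
have [d1 _] := test_fun_dy tphi; have [d2 _] := test_fun_dy tpsi.
rewrite (_ : dy (fun p => phi p * psi p) = fun p => phi p * dy psi p + dy phi p * psi p).
  rewrite int_OmegaD; first by move/eqP; rewrite addr_eq0 => /eqP.
    by apply: L2_Omega_mul; [exact: test_fun_L2|exact: dy_L2].
  by apply: L2_Omega_mul; [exact: dy_L2|exact: test_fun_L2].
apply/funext => p; apply: is_derive_dyE.
have := is_derive_mul (d1 p) (d2 p); rewrite -surjective_pairing.
by rewrite (mulrC (dy phi p)).
Qed.

(** Weak differentiation is a closed operator, since both sides of its defining identity are L^2
    pairings with a fixed function. It yields the weak derivatives of [G]. *)
Lemma is_weak_deriv_lim d (f_ g_ : nat -> R * R -> R) u g :
  (forall phi, test_fun phi -> L2_Omega (d phi)) ->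
  (forall n, L2_Omega (f_ n)) -> (forall n, is_weak_deriv d (f_ n) (g_ n)) ->
  L2_Omega u -> L2_Omega g ->
  int_Omega (fun p => (f_ n p - u p) ^+ 2) @[n --> \oo] --> (0 : R) ->
  int_Omega (fun p => (g_ n p - g p) ^+ 2) @[n --> \oo] --> (0 : R) ->
  is_weak_deriv d u g.
Proof.
move=> dL Lf Hfg Lu Lg cf cg; split=> // phi tphi.
have c1 := cvg_L2_mul mO Lf Lu (dL _ tphi) cf.
have c2 := cvg_L2_mul mO (fun n => (Hfg n).1) Lg (test_fun_L2 tphi) cg.
have c3 : int_Omega (fun p => f_ n p * d phi p) @[n --> \oo] -->
    - int_Omega (fun p => g p * phi p).
  rewrite (_ : (fun n => _) = (fun n => - int_Omega (fun p => g_ n p * phi p))).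
    by apply: cvgN; exact: c2.
  by apply/funext => n; have [_ ->] := Hfg n.
exact: (cvg_unique _ c1 c3).
Qed.

Lemma H1_norm_test_sub u gx gy phi : L2_Omega u ->
  is_weak_deriv (@dx R) u gx -> is_weak_deriv (@dy R) u gy -> test_fun phi ->
  H1_norm (phi \- u) = Num.sqrt (int_Omega (fun p => (phi p - u p) ^+ 2) +
    (int_Omega (fun p => (dx phi p - gx p) ^+ 2) +
     int_Omega (fun p => (dy phi p - gy p) ^+ 2))).
Proof.
move=> Lu ux uy tphi; have Lp := test_fun_L2 tphi.
apply: H1_normE; first exact: L2_Omega_sub.
- exact: is_weak_deriv_sub dx_L2 Lp Lu (test_fun_weak_dx tphi) ux.
- exact: is_weak_deriv_sub dy_L2 Lp Lu (test_fun_weak_dy tphi) uy.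
Qed.

Lemma H1_norm_subC u gx gy phi : L2_Omega u ->
  is_weak_deriv (@dx R) u gx -> is_weak_deriv (@dy R) u gy -> test_fun phi ->
  H1_norm (u \- phi) = H1_norm (phi \- u).
Proof.
move=> Lu ux uy tphi; have Lp := test_fun_L2 tphi.
rewrite (H1_norm_test_sub Lu ux uy tphi).
rewrite (@H1_normE _ (gx \- dx phi) (gy \- dy phi)).
- congr (Num.sqrt (_ + (_ + _))); apply: eq_int_Omega => p /=;
    by rewrite -sqrrN opprB.
- exact: L2_Omega_sub.
- exact: is_weak_deriv_sub dx_L2 Lu Lp ux (test_fun_weak_dx tphi).
- exact: is_weak_deriv_sub dy_L2 Lu Lp uy (test_fun_weak_dy tphi).
Qed.

End weak_derivatives.

(** * The Green function belongs to the closure of the test functions *)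

Section green_function.
Variable R : realType.
Notation plane := (measurableTypeR R * measurableTypeR R)%type.
Notation leb := (@lebesgue_measure R).
Notation leb2 := (leb \x leb)%E.
Implicit Types (p : R * R) (t l : R) (n : nat).

(** A smooth positive part, lying between (t - 1 / (n + 1))^+ and t^+. With s = (n + 1) t, the
    product rule produces the term s [flat 2 s], which is [flat 1 s]; hence the form of the
    derivative [spos']. *)
Definition spos n t : R := t * flat 0 (n.+1%:R * t).
Definition spos' n t : R := flat 0 (n.+1%:R * t) + flat 1 (n.+1%:R * t).

Lemma is_derive_spos n t : is_derive t 1 (spos n) (spos' n t).
Proof.
have dl : is_derive t 1 (fun s => n.+1%:R * s) (n.+1%:R * 1).
  exact: is_deriveZ.
have df := is_derive1_comp (is_derive_flat 0 (n.+1%:R * t)) dl.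
have := is_derive_mul (is_derive_id t 1) df.
rewrite /spos' mulr1 mul0r subr0 /=.
rewrite (_ : t * _ + _ = flat 0 (n.+1%:R * t) + flat 1 (n.+1%:R * t)) //.
by rewrite -(mul_flatS 1); ring.
Qed.

Lemma spos_ge0 n t : 0 <= spos n t.
Proof.
have [t0|t0] := leP 0 t; first by rewrite mulr_ge0// flat_ge0.
by rewrite /spos flat_le0 ?mulr0// pmulr_rle0// ltW.
Qed.

Lemma spos_le n t : spos n t <= Num.max t 0.
Proof.
have [t0|t0] := leP t 0.
  by rewrite /spos flat_le0 ?mulr0// pmulr_rle0.
by rewrite /spos ler_piMr ?flat0_le1// ltW.
Qed.

Lemma spos_ge n t : t - n.+1%:R^-1 <= spos n t.
Proof.
have [t0|t0] := leP t 0.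
  by rewrite (le_trans _ (spos_ge0 n t))// subr_le0 (le_trans t0)// invr_ge0.
have n0 : 0 < n.+1%:R :> R by [].
have := flat0_ge (mulr_gt0 n0 t0); rewrite -(ler_pM2l t0); apply: le_trans.
rewrite le_eqVlt; apply/orP; left; apply/eqP.
by rewrite mulrBr mulr1 invfM mulrCA divff ?mulr1// gt_eqF.
Qed.

Lemma spos_neq0 n t : spos n t != 0 -> 0 < t.
Proof.
rewrite ltNge; apply: contraNN => t0; rewrite /spos flat_le0 ?mulr0//.
by rewrite pmulr_rle0.
Qed.

(** A bound uniform in [n]: it allows dominated convergence for the gradients of [Gn]. *)
Lemma spos'_bounds n t : 0 <= spos' n t <= 1.
Proof. by rewrite addr_ge0 ?flat_ge0//= flat01_le1. Qed.

Lemma cvg_spos (u : nat -> R) l : u n @[n --> \oo] --> l -> 0 < l ->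
  spos n (u n) @[n --> \oo] --> l.
Proof.
move=> ul l0; rewrite -[X in _ --> X]mulr1; apply: cvgM => //.
exact: cvg_flat0 ul l0.
Qed.

Lemma cvg_spos' (u : nat -> R) l : u n @[n --> \oo] --> l -> 0 < l ->
  spos' n (u n) @[n --> \oo] --> (1 : R).
Proof.
move=> ul l0; rewrite -[X in _ --> X]addr0; apply: cvgD.
  exact: cvg_flat0 ul l0.
exact: cvg_flat1 ul l0.
Qed.

Lemma cvg_spos'_cst t : spos' n t @[n --> \oo] --> ((0 < t)%R%:R : R).
Proof.
have [t0|t0] := ltP 0 t; first exact: (cvg_spos' (cvg_cst t) t0).
rewrite (_ : (fun n => spos' n t) = fun=> 0); first exact: cvg_cst.
by apply/funext => n; rewrite /spos' !flat_le0 ?addr0// pmulr_rle0.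
Qed.

Lemma cvg_spos_cst t : spos n t @[n --> \oo] --> (Num.max t 0 : R).
Proof.
have [t0|t0] := leP t 0; last exact: (cvg_spos (cvg_cst t) t0).
rewrite (_ : (fun n => spos n t) = fun=> 0); first exact: cvg_cst.
by apply/funext => n; rewrite /spos flat_le0 ?mulr0// pmulr_rle0.
Qed.

Lemma Cn_spos (k : nat) n (h : R * R -> R) : Cn k h -> Cn k (fun p => spos n (h p)).
Proof.
move=> Ch; apply: CnM => //.
apply: (@Cn_comp _ k (flat 0) (fun p => n.+1%:R * h p)); first exact: Cn1_flat.
by apply: CnM => //; exact: Cn_cst.
Qed.

(* On [Omega], [G = min x y * min (1 - x) (1 - y)] with
   [min x y = x - (x - y)^+] and [min (1 - x) (1 - y) = 1 - y - (x - y)^+];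
   every positive part is smoothed by [spos], and the shift by [2 / (n + 1)]
   makes the support compact. *)
Definition Gmin n p : R := p.1 - spos n (p.1 - p.2) - 2 * n.+1%:R^-1.
Definition Gmax n p : R := 1 - p.2 - spos n (p.1 - p.2) - 2 * n.+1%:R^-1.
Definition Gn n p : R := spos n (Gmin n p) * spos n (Gmax n p).

Definition Gn_x n p : R :=
  spos n (Gmin n p) * (spos' n (Gmax n p) * (- spos' n (p.1 - p.2))) +
  spos n (Gmax n p) * (spos' n (Gmin n p) * (1 - spos' n (p.1 - p.2))).
Definition Gn_y n p : R :=
  spos n (Gmin n p) * (spos' n (Gmax n p) * (spos' n (p.1 - p.2) - 1)) +
  spos n (Gmax n p) * (spos' n (Gmin n p) * spos' n (p.1 - p.2)).

Lemma test_fun_Gn n : test_fun (Gn n).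
Proof.
apply: (@test_fun_build _ _ n.+1%:R^-1); first by rewrite invr_gt0.
  move=> k.
  have Cw : Cn k (fun p => spos n (p.1 - p.2)).
    by apply: Cn_spos; apply: CnB; [exact: Cn_fst|exact: Cn_snd].
  apply: CnM; apply: Cn_spos; apply: CnB; try exact: Cn_cst; apply: CnB => //.
    exact: Cn_fst.
  by apply: CnB; [exact: Cn_cst|exact: Cn_snd].
(* The smoothed positive part may fall short of x - y by up to e = 1 / (n + 1). A shift by 2 e
   absorbs this and leaves a margin: positivity of [Gmin] gives x > 2 e and y > e, positivity of
   [Gmax] gives y < 1 - 2 e and x < 1 - e. *)
move=> p; rewrite mulf_eq0 negb_or => /andP[/spos_neq0 + /spos_neq0].
have := spos_ge n (p.1 - p.2); have := spos_ge0 n (p.1 - p.2).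
rewrite /Gmin /Gmax; have : 0 < n.+1%:R^-1 :> R by rewrite invr_gt0.
move: (spos _ _) (n.+1%:R^-1) => w e e0 w0 w1 a b.
by split; lra.
Qed.

Lemma is_derive_spos_comp n (f : R -> R) (t df : R) : is_derive t 1 f df ->
  is_derive t 1 (fun s => spos n (f s)) (spos' n (f t) * df).
Proof. by move=> d; exact: (is_derive1_comp (is_derive_spos n (f t)) d). Qed.

Lemma is_derive_sub_shift (f g : R -> R) (t a b c : R) :
  is_derive t 1 f a -> is_derive t 1 g b ->
  is_derive t 1 (fun s => f s - g s - c) (a - b).
Proof.
move=> df dg; rewrite -[a - b]subr0.
exact: (is_deriveB (is_deriveB df dg) (is_derive_cst c t 1)).
Qed.

Lemma dx_Gn n : dx (Gn n) = Gn_x n.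
Proof.
apply/funext => p; apply: is_derive_dxE.
have dw : is_derive p.1 1 (fun s => spos n (s - p.2)) (spos' n (p.1 - p.2) * (1 - 0)).
  by apply: is_derive_spos_comp; apply: is_deriveB.
have dA : is_derive p.1 1 (fun s => Gmin n (s, p.2)) (1 - spos' n (p.1 - p.2) * (1 - 0)).
  exact: (is_derive_sub_shift _ (is_derive_id p.1 1) dw).
have dB : is_derive p.1 1 (fun s => Gmax n (s, p.2)) (0 - spos' n (p.1 - p.2) * (1 - 0)).
  exact: (is_derive_sub_shift _ (is_derive_cst (1 - p.2) p.1 1) dw).
rewrite subr0 mulr1 in dA; rewrite subr0 mulr1 sub0r in dB.
have := is_derive_mul (is_derive_spos_comp n dA) (is_derive_spos_comp n dB).
by rewrite -surjective_pairing.
Qed.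

Lemma dy_Gn n : dy (Gn n) = Gn_y n.
Proof.
apply/funext => p; apply: is_derive_dyE.
have dw : is_derive p.2 1 (fun s => spos n (p.1 - s)) (spos' n (p.1 - p.2) * (0 - 1)).
  by apply: is_derive_spos_comp; apply: is_deriveB.
have dA : is_derive p.2 1 (fun s => Gmin n (p.1, s)) (0 - spos' n (p.1 - p.2) * (0 - 1)).
  exact: (is_derive_sub_shift _ (is_derive_cst p.1 p.2 1) dw).
have d1 : is_derive p.2 1 (fun s => 1 - s) (0 - 1) by exact: is_deriveB.
have dB : is_derive p.2 1 (fun s => Gmax n (p.1, s))
    (0 - 1 - spos' n (p.1 - p.2) * (0 - 1)).
  exact: (is_derive_sub_shift _ d1 dw).
rewrite !sub0r mulrN1 opprK in dA; rewrite !sub0r mulrN1 opprK addrC in dB.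
have := is_derive_mul (is_derive_spos_comp n dA) (is_derive_spos_comp n dB).
by rewrite -surjective_pairing.
Qed.

Lemma spos_Gmin_le1 n p : Omega p -> 0 <= spos n (Gmin n p) <= 1.
Proof.
move=> [/andP[x0 x1] _]; rewrite spos_ge0/= (le_trans (spos_le _ _))//.
rewrite ge_max ler01 andbT /Gmin; have := spos_ge0 n (p.1 - p.2).
have : 0 < n.+1%:R^-1 :> R by rewrite invr_gt0.
by move: (spos _ _) (n.+1%:R^-1) => w e; lra.
Qed.

Lemma spos_Gmax_le1 n p : Omega p -> 0 <= spos n (Gmax n p) <= 1.
Proof.
move=> [_ /andP[x0 x1]]; rewrite spos_ge0/= (le_trans (spos_le _ _))//.
rewrite ge_max ler01 andbT /Gmax; have := spos_ge0 n (p.1 - p.2).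
have : 0 < n.+1%:R^-1 :> R by rewrite invr_gt0.
by move: (spos _ _) (n.+1%:R^-1) => w e; lra.
Qed.

Lemma Gn_le1 n p : Omega p -> `|Gn n p| <= 1.
Proof.
move=> Op; have /andP[a0 a1] := spos_Gmin_le1 n Op.
have /andP[b0 b1] := spos_Gmax_le1 n Op.
by rewrite /Gn normrM !ger0_norm//; exact: mulr_ile1.
Qed.

Let bound_aux (a s w : R) : 0 <= a <= 1 -> 0 <= s <= 1 -> `|w| <= 1 ->
  `|a * (s * w)| <= 1.
Proof.
move=> /andP[a0 a1] /andP[s0 s1] w1.
by rewrite !normrM !(ger0_norm a0, ger0_norm s0) !mulr_ile1// ?mulr_ge0.
Qed.

Lemma Gn_x_le2 n p : Omega p -> `|Gn_x n p| <= 2.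
Proof.
move=> Op; have A := spos_Gmin_le1 n Op; have B := spos_Gmax_le1 n Op.
have sA := spos'_bounds n (Gmin n p); have sB := spos'_bounds n (Gmax n p).
have /andP[w0 w1] := spos'_bounds n (p.1 - p.2).
rewrite (le_trans (ler_normD _ _))// -[leRHS]/(1 + 1 : R) lerD//.
  by apply: (bound_aux A sB); rewrite normrN ger0_norm.
by apply: (bound_aux B sA); rewrite ger0_norm ?subr_ge0// gerBl.
Qed.

Lemma Gn_y_le2 n p : Omega p -> `|Gn_y n p| <= 2.
Proof.
move=> Op; have A := spos_Gmin_le1 n Op; have B := spos_Gmax_le1 n Op.
have sA := spos'_bounds n (Gmin n p); have sB := spos'_bounds n (Gmax n p).
have /andP[w0 w1] := spos'_bounds n (p.1 - p.2).
rewrite (le_trans (ler_normD _ _))// -[leRHS]/(1 + 1 : R) lerD//.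
  by apply: (bound_aux A sB); rewrite distrC ger0_norm ?subr_ge0// gerBl.
by apply: (bound_aux B sA); rewrite ger0_norm.
Qed.

Lemma cvg_Gmin p : Gmin n p @[n --> \oo] --> p.1 - Num.max (p.1 - p.2) 0.
Proof.
rewrite -[X in _ --> X]subr0; apply: cvgB.
  by apply: cvgB; [exact: cvg_cst|exact: cvg_spos_cst].
by rewrite -(mulr0 2); apply: cvgMr; exact: cvg_harmonic.
Qed.

Lemma cvg_Gmax p : Gmax n p @[n --> \oo] --> 1 - p.2 - Num.max (p.1 - p.2) 0.
Proof.
rewrite -[X in _ --> X]subr0; apply: cvgB.
  by apply: cvgB; [exact: cvg_cst|exact: cvg_spos_cst].
by rewrite -(mulr0 2); apply: cvgMr; exact: cvg_harmonic.
Qed.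

Section limits.
Variables (p : R * R) (Op : Omega p).

(** [A] and [B] are min x y and min (1 - x) (1 - y). Their strict positivity on [Omega] is what
    makes [spos' n] converge to 1 along the moving arguments [Gmin n p] and [Gmax n p]. *)
Let A : R := p.1 - Num.max (p.1 - p.2) 0.
Let B : R := 1 - p.2 - Num.max (p.1 - p.2) 0.
Let A0 : 0 < A.
Proof.
have [/andP[x0 x1] /andP[y0 y1]] := Op.
by rewrite /A subr_gt0 gt_max x0 andbT; lra.
Qed.
Let B0 : 0 < B.
Proof.
have [/andP[x0 x1] /andP[y0 y1]] := Op.
by rewrite /B subr_gt0 gt_max; lra.
Qed.

Lemma cvg_Gn : Gn n p @[n --> \oo] --> G p.
Proof.
have -> : G p = A * B.
  rewrite /G /A /B; have [yx|yx] := leP p.2 p.1.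
    by rewrite (max_l _) ?subr_ge0//; ring.
  by rewrite (max_r _) ?subr_le0 ?ltW//; ring.
by apply: cvgM; apply: cvg_spos => //; [exact: cvg_Gmin|exact: cvg_Gmax].
Qed.

Lemma cvg_Gn_x : Gn_x n p @[n --> \oo] --> Gx p.
Proof.
have -> : Gx p = A * (1 * (- (0 < p.1 - p.2)%R%:R)) + B * (1 * (1 - (0 < p.1 - p.2)%R%:R)).
  rewrite /Gx /A /B subr_gt0; have [xy|yx] := leP p.1 p.2.
    by rewrite (max_r _) ?subr_le0//=; ring.
  by rewrite (max_l _) ?subr_ge0 ?ltW//=; ring.
have cA : Gmin n p @[n --> \oo] --> A by exact: cvg_Gmin.
have cB : Gmax n p @[n --> \oo] --> B by exact: cvg_Gmax.
have cw := @cvg_spos'_cst (p.1 - p.2).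
apply: cvgD; apply: cvgM; try exact: cvg_spos; apply: cvgM;
  try by [exact: cvg_spos' A0|exact: cvg_spos' B0].
  exact: cvgN.
by apply: cvgB => //; exact: cvg_cst.
Qed.

Lemma cvg_Gn_y : Gn_y n p @[n --> \oo] --> Gy p.
Proof.
have -> : Gy p = A * (1 * ((0 < p.1 - p.2)%R%:R - 1)) + B * (1 * (0 < p.1 - p.2)%R%:R).
  rewrite /Gy /A /B subr_gt0; have [xy|yx] := leP p.1 p.2.
    by rewrite (max_r _) ?subr_le0//=; ring.
  by rewrite (max_l _) ?subr_ge0 ?ltW//=; ring.
have cA : Gmin n p @[n --> \oo] --> A by exact: cvg_Gmin.
have cB : Gmax n p @[n --> \oo] --> B by exact: cvg_Gmax.
have cw := @cvg_spos'_cst (p.1 - p.2).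
apply: cvgD; apply: cvgM; try exact: cvg_spos; apply: cvgM => //;
  try by [exact: cvg_spos' A0|exact: cvg_spos' B0].
by apply: cvgB => //; exact: cvg_cst.
Qed.

End limits.

Let mO := @measurable_Omega R.
Let fO := @leb2_Omega R.

Lemma cvg_Gn_L2 : L2_Omega (@G R) /\
  int_Omega (fun p => (Gn n p - G p) ^+ 2) @[n --> \oo] --> (0 : R).
Proof.
apply: (@cvg_bounded_L2 _ plane R leb2 _ mO fO _ _ 1).
- by move=> n; apply: continuous_measurable_plane; exact: test_fun_continuous (test_fun_Gn n).
- by move=> n p; exact: Gn_le1.
- by move=> p; exact: cvg_Gn.
Qed.

Lemma cvg_Gn_x_L2 : L2_Omega (@Gx R) /\
  int_Omega (fun p => (dx (Gn n) p - Gx p) ^+ 2) @[n --> \oo] --> (0 : R).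
Proof.
apply: (@cvg_bounded_L2 _ plane R leb2 _ mO fO _ _ 2).
- by move=> n; apply: continuous_measurable_plane; have [] := test_fun_dx (test_fun_Gn n).
- by move=> n p; rewrite dx_Gn; exact: Gn_x_le2.
- by move=> p Op; under eq_fun do rewrite dx_Gn; exact: cvg_Gn_x.
Qed.

Lemma cvg_Gn_y_L2 : L2_Omega (@Gy R) /\
  int_Omega (fun p => (dy (Gn n) p - Gy p) ^+ 2) @[n --> \oo] --> (0 : R).
Proof.
apply: (@cvg_bounded_L2 _ plane R leb2 _ mO fO _ _ 2).
- by move=> n; apply: continuous_measurable_plane; have [] := test_fun_dy (test_fun_Gn n).
- by move=> n p; rewrite dy_Gn; exact: Gn_y_le2.
- by move=> p Op; under eq_fun do rewrite dy_Gn; exact: cvg_Gn_y.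
Qed.

Lemma weak_dx_G : is_weak_deriv (@dx R) (@G R) (@Gx R).
Proof.
have [LG cG] := cvg_Gn_L2; have [LGx cGx] := cvg_Gn_x_L2.
apply: (is_weak_deriv_lim (@dx_L2 R) _ _ LG LGx cG cGx) => n.
- exact: test_fun_L2 (test_fun_Gn n).
- exact: test_fun_weak_dx (test_fun_Gn n).
Qed.

Lemma weak_dy_G : is_weak_deriv (@dy R) (@G R) (@Gy R).
Proof.
have [LG cG] := cvg_Gn_L2; have [LGy cGy] := cvg_Gn_y_L2.
apply: (is_weak_deriv_lim (@dy_L2 R) _ _ LG LGy cG cGy) => n.
- exact: test_fun_L2 (test_fun_Gn n).
- exact: test_fun_weak_dy (test_fun_Gn n).
Qed.

Lemma H10_G : H10 (@G R).
Proof.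
have [LG cG] := cvg_Gn_L2; have [_ cGx] := cvg_Gn_x_L2; have [_ cGy] := cvg_Gn_y_L2.
split.
  by split=> //; [exists (@Gx R); exact: weak_dx_G|exists (@Gy R); exact: weak_dy_G].
move=> e e0.
have c : H1_norm (Gn n \- @G R) @[n --> \oo] --> (0 : R).
  under eq_fun do rewrite (H1_norm_test_sub LG weak_dx_G weak_dy_G (test_fun_Gn _)).
  rewrite -(sqrtr0 R); apply: continuous_cvg; first exact: sqrt_continuous.
  rewrite -[X in _ --> X](addr0 (0 : R)) -[X in _ --> (_ + X)](addr0 (0 : R)).
  by apply: cvgD => //; exact: cvgD.
have [n _ /(_ n (leqnn n)) Hn] := cvgr_lt _ c e e0.
exists (Gn n); first exact: test_fun_Gn.
by rewrite (H1_norm_subC LG weak_dx_G weak_dy_G (test_fun_Gn n)).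
Qed.

End green_function.

(** * The trace on the diagonal *)

(** The arithmetic of the Cauchy estimate: [a] and [b] stand for the squared distances between two
    approximations and between their x-derivatives, each split through the limit. *)
Lemma ler_parallelogram (R : realFieldType) (a b a1 b1 a2 b2 k : R) :
  a <= 2 * a1 + 2 * a2 -> b <= 2 * b1 + 2 * b2 ->
  a1 + b1 <= k -> a2 + b2 <= k -> a + b <= 4 * k.
Proof. lra. Qed.

Section trace.
Variable R : realType.
Notation plane := (measurableTypeR R * measurableTypeR R)%type.
Notation leb := (@lebesgue_measure R).
Notation leb2 := (leb \x leb)%E.
Notation I01 := (`]0, 1[%classic : set (measurableTypeR R)).
Notation Int01 k := (\int[leb]_(t in `]0, 1[) k t).
Implicit Types (phi u g : R * R -> R) (t : R).

Let mO := @measurable_Omega R.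

Let m01 : measurable I01.
Proof. exact: measurable_itv. Qed.

Let f01 : (leb I01 < +oo)%E.
Proof. by rewrite lebesgue_measure_itv/= lte_fin ltr01 -EFinB ltry. Qed.

Lemma speed_diag t : speed (@diag R) t = Num.sqrt 2.
Proof.
rewrite /speed /= derive1_id expr1n; congr Num.sqrt.
Qed.

Lemma sqrt2_gt0 : 0 < Num.sqrt 2 :> R.
Proof. by rewrite sqrtr_gt0. Qed.

Lemma L2_GammaP g : L2_Gamma g <-> L2 leb I01 (g \o @diag R).
Proof.
have s0 : Num.sqrt 2 != 0 :> R by rewrite gt_eqF// sqrt2_gt0.
split => -[mg Ig]; split => //.
- have := intbleZ m01 (Num.sqrt 2)^-1 Ig; apply: eq_integrable => // t _ /=.
  by rewrite speed_diag mulrC mulfK.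
- have := intbleZ m01 (Num.sqrt 2) Ig; apply: eq_integrable => // t _ /=.
  by rewrite speed_diag mulrC.
Qed.

Lemma int_GammaE g : leb.-integrable I01 (EFin \o (g \o @diag R)) ->
  int_Gamma g = Num.sqrt 2 * Int01 (fun t => g (t, t)).
Proof.
move=> Ig; rewrite -(RintegralZl _ m01 Ig).
by apply: eq_Rintegral => t _; rewrite speed_diag mulrC.
Qed.

Lemma L2_Gamma_normE g : L2 leb I01 (g \o @diag R) ->
  L2_Gamma_norm g = Num.sqrt (Num.sqrt 2 * Int01 (fun t => g (t, t) ^+ 2)).
Proof. by move=> Lg; congr Num.sqrt; exact: (int_GammaE (L2_sqr Lg)). Qed.

Lemma test_fun_L2_diag phi : test_fun phi -> L2 leb I01 (phi \o @diag R).
Proof.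
move=> tphi; have cphi := test_fun_continuous tphi.
have [M HM] := continuous_bounded_Omega cphi.
apply: (@L2_bounded _ _ _ leb _ m01 f01 _ M).
  apply: measurable_funTS; apply: continuous_measurable_fun => t.
  apply: (@continuous2_cvg _ _ _ _ _ _ id id (fun a b => phi (a, b)) t t);
    [|exact: cvg_id..].
  by under eq_fun do rewrite -surjective_pairing; exact: cphi.
by move=> t /=; rewrite in_itv/= => t01; apply: HM.
Qed.

(** The constant 1 comes from |Gx| <= 1 and 2 |a b| <= a^2 + b^2, applied to the derivative 2 phi
    (dx phi) of the square. The x-derivative alone controls the diagonal. *)
Lemma trace_inequality phi : test_fun phi ->
  Int01 (fun t => phi (t, t) ^+ 2) <=
  int_Omega (fun p => phi p ^+ 2) + int_Omega (fun p => dx phi p ^+ 2).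
Proof.
move=> tphi; have t2 : test_fun (fun p => phi p * phi p).
  by apply: test_funM => //; case: tphi.
have [d c] := test_fun_dx tphi; have Lp := test_fun_L2 tphi; have Lx := dx_L2 tphi.
have E : dx (fun p => phi p * phi p) = fun p => 2 * (phi p * dx phi p).
  apply/funext => p; apply: is_derive_dxE.
  by have := is_derive_mul (d p) (d p); rewrite -surjective_pairing mulr2n mulrDl mul1r.
have -> : Int01 (fun t => phi (t, t) ^+ 2) =
    int_Omega (fun p => 2 * (phi p * dx phi p) * Gx p).
  have := int_dx_Gx t2; rewrite E => ->.
  by apply: eq_Rintegral => t _; rewrite expr2.
rewrite -int_OmegaD; [|exact: L2_Omega_sqr..].
have I1 : leb2.-integrable (@Omega R : set plane)
    (EFin \o (fun p : plane => phi p ^+ 2 + dx phi p ^+ 2)).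
  by apply: (intbleD mO); exact: L2_Omega_sqr.
have bnd p : Omega p -> `|2 * (phi p * dx phi p) * Gx p| <= phi p ^+ 2 + dx phi p ^+ 2.
  move=> Op; rewrite normrM; apply: (@le_trans _ _ `|2 * (phi p * dx phi p)|).
    by rewrite ler_piMr// Gx_le1.
  have := sqr_ge0 (phi p - dx phi p); have := sqr_ge0 (phi p + dx phi p).
  by rewrite ler_norml; nra.
apply: le_Rintegral => //.
  apply: (@intble_dominated _ _ _ leb2 _ mO _
    (fun p : plane => phi p ^+ 2 + dx phi p ^+ 2)) => //.
  apply: measurable_funM; last exact: measurable_Gx.
  apply: measurable_funM; first exact: measurable_cst.
  by apply: measurable_funM; [case: Lp|case: Lx].
by move=> p Op; exact: le_trans (ler_norm _) (bnd p Op).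
Qed.

Lemma int_Omega_sqr_ge0 u : 0 <= int_Omega (fun p => u p ^+ 2).
Proof. by apply: Rintegral_ge0 => p _; exact: sqr_ge0. Qed.

Section H1_convergence.
Variables (u gx gy : R * R -> R).
Hypotheses (Lu : L2_Omega u) (ux : is_weak_deriv (@dx R) u gx)
  (uy : is_weak_deriv (@dy R) u gy).

Lemma H1_norm_sqr phi : test_fun phi ->
  H1_norm (phi \- u) ^+ 2 = int_Omega (fun p => (phi p - u p) ^+ 2) +
    (int_Omega (fun p => (dx phi p - gx p) ^+ 2) +
     int_Omega (fun p => (dy phi p - gy p) ^+ 2)).
Proof.
move=> tphi; rewrite (H1_norm_test_sub Lu ux uy tphi) sqr_sqrtr//.
by rewrite !addr_ge0// int_Omega_sqr_ge0.
Qed.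

Lemma cvg_grad_G (phi : nat -> R * R -> R) : (forall n, test_fun (phi n)) ->
  H1_norm (phi n \- u) @[n --> \oo] --> (0 : R) ->
  2 * Int01 (fun t => phi n (t, t)) @[n --> \oo] --> int_Omega (grad_dot u (@G R)).
Proof.
move=> tphi c.
have c2 : H1_norm (phi n \- u) ^+ 2 @[n --> \oo] --> (0 : R).
  by under eq_fun do rewrite expr2; rewrite -(mulr0 (0 : R)); exact: cvgM.
have cx : int_Omega (fun p => (dx (phi n) p - gx p) ^+ 2) @[n --> \oo] --> (0 : R).
  apply: (@squeeze_cvgr _ _ _ _ (fun=> 0) _ _ _ _ (cvg_cst 0) c2).
  near=> n; rewrite int_Omega_sqr_ge0/= H1_norm_sqr// addrCA lerDl.
  by rewrite addr_ge0// int_Omega_sqr_ge0.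
have cy : int_Omega (fun p => (dy (phi n) p - gy p) ^+ 2) @[n --> \oo] --> (0 : R).
  apply: (@squeeze_cvgr _ _ _ _ (fun=> 0) _ _ _ _ (cvg_cst 0) c2).
  near=> n; rewrite int_Omega_sqr_ge0/= H1_norm_sqr// addrA lerDr.
  by rewrite addr_ge0// int_Omega_sqr_ge0.
have [LGx _] := weak_dx_G R; have [LGy _] := weak_dy_G R.
rewrite (int_grad_dot ux uy (weak_dx_G R) (weak_dy_G R)).
have -> : (fun n => 2 * Int01 (fun t => phi n (t, t))) = (fun n =>
    int_Omega (fun p => dx (phi n) p * Gx p) + int_Omega (fun p => dy (phi n) p * Gy p)).
  by apply/funext => n; rewrite int_dx_Gx// int_dy_Gy//; ring.
apply: cvgD.
- exact: (cvg_L2_mul mO (fun n => dx_L2 (tphi n)) (proj1 ux) LGx cx).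
- exact: (cvg_L2_mul mO (fun n => dy_L2 (tphi n)) (proj1 uy) LGy cy).
Unshelve. all: by end_near. Qed.

Lemma is_trace_exists :
  (forall e : R, 0 < e -> exists2 phi, test_fun phi & H1_norm (u \- phi) < e) ->
  exists g, is_trace u g.
Proof.
move=> dens.
(* The rate is fitted to [L2_complete]: an error below 2^-(m+1) has square at most 4^-(m+1), and the
   factor 4 of the parallelogram estimate turns this into exactly 4^-m. *)
have /choice[phi Hphi] (n : nat) : exists phi,
    test_fun phi /\ H1_norm (phi \- u) < 2 ^- n.+1.
  have e0 : 0 < 2 ^- n.+1 :> R by rewrite invr_gt0 exprn_gt0.
  have [phi tphi H] := dens _ e0; exists phi; split; first exact: tphi.
  by rewrite -(H1_norm_subC Lu ux uy tphi).
have tphi n : test_fun (phi n) by case: (Hphi n).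
have N0 v : 0 <= H1_norm v by exact: sqrtr_ge0.
have Nlt n : H1_norm (phi n \- u) < 2 ^- n.+1 by case: (Hphi n).
pose E n := int_Omega (fun p => (phi n p - u p) ^+ 2) +
  int_Omega (fun p => (dx (phi n) p - gx p) ^+ 2).
have E4 n : E n <= 4 ^- n.+1.
  apply: (@le_trans _ _ (H1_norm (phi n \- u) ^+ 2)).
    by rewrite H1_norm_sqr// addrA lerDl int_Omega_sqr_ge0.
  have -> : 4 ^- n.+1 = (2 ^- n.+1) ^+ 2 :> R.
    by rewrite exprVn -exprM mulnC exprM; congr ((_ ^+ _)^-1); rewrite expr2; ring.
  by rewrite !expr2; apply: ler_pM; [exact: N0..|exact: ltW (Nlt n)|exact: ltW (Nlt n)].
have sub2 (a b c : R * R -> R) : L2_Omega a -> L2_Omega b -> L2_Omega c ->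
    int_Omega (fun p => (a p - b p) ^+ 2) <=
    2 * int_Omega (fun p => (a p - c p) ^+ 2) + 2 * int_Omega (fun p => (b p - c p) ^+ 2).
  move=> La Lb Lc.
  have Sac := L2_Omega_sqr (L2_Omega_sub La Lc).
  have Sbc := L2_Omega_sqr (L2_Omega_sub Lb Lc).
  rewrite /int_Omega -(RintegralZl _ mO Sac) -(RintegralZl _ mO Sbc).
  have Zac := intbleZ mO 2 Sac; have Zbc := intbleZ mO 2 Sbc.
  rewrite -(RintegralD mO Zac Zbc); apply: le_Rintegral => //.
  - exact: L2_Omega_sqr (L2_Omega_sub La Lb).
  - exact: (intbleD mO Zac Zbc).
  - by move=> p _ /=; have := sqr_ge0 ((a p - c p) + (b p - c p)); nra.
have cau m n : (m <= n)%N ->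
    Int01 (fun t => ((phi n \o @diag R) t - (phi m \o @diag R) t) ^+ 2) <= 4 ^- m.
  move=> mn; have tB := test_funB (tphi n) (tphi m).
  apply: le_trans (trace_inequality tB) _.
  have [dn _] := test_fun_dx (tphi n); have [dm _] := test_fun_dx (tphi m).
  have -> : dx (phi n \- phi m) = dx (phi n) \- dx (phi m).
    by apply/funext => p; apply: is_derive_dxE; exact: is_deriveB.
  have H1 := sub2 _ _ _ (test_fun_L2 (tphi n)) (test_fun_L2 (tphi m)) Lu.
  have H2 := sub2 _ _ _ (dx_L2 (tphi n)) (dx_L2 (tphi m)) (proj1 ux).
  have le4 : 4 ^- n.+1 <= 4 ^- m.+1 :> R.
    by rewrite lef_pV2 ?posrE ?exprn_gt0// ler_eXn2l// ltr1n.
  have -> : 4 ^- m = 4 * 4 ^- m.+1 :> R.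
    by rewrite exprS invfM mulrA divff ?mul1r// pnatr_eq0.
  exact: (ler_parallelogram H1 H2 (le_trans (E4 n) le4) (E4 m)).
have [g1 Lg1 cg1] := L2_complete m01 f01 (fun n => test_fun_L2_diag (tphi n)) cau.
(* Any extension off the diagonal will do; this one composes with [diag] to give back [g1]. *)
pose g (p : R * R) := g1 p.1.
exists g; split; first by apply/L2_GammaP.
exists phi; split; first exact: tphi.
- apply: (@squeeze_cvgr _ _ _ _ (fun=> 0) (fun n => 2 ^- n.+1)).
  + by near=> n; rewrite N0/= ltW.
  + exact: cvg_cst.
  + rewrite (cvg_shiftS (fun n => 2 ^- n : R)); under eq_fun do rewrite -exprVn.
    by apply: cvg_expr; rewrite ger0_norm ?invr_ge0// invf_lt1// ltr1n.
- have -> : (fun n => L2_Gamma_norm (phi n \- g)) = (fun n => Num.sqrt (Num.sqrt 2 *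
      Int01 (fun t => ((phi n \o @diag R) t - g1 t) ^+ 2))).
    apply/funext => n; rewrite L2_Gamma_normE//.
    exact: (L2_sub m01 (test_fun_L2_diag (tphi n)) Lg1).
  rewrite -[X in _ --> X](sqrtr0 R); apply: continuous_cvg; first exact: sqrt_continuous.
  by rewrite -[X in _ --> X](mulr0 (Num.sqrt 2)); apply: cvgMr.
Unshelve. all: by end_near. Qed.

Lemma is_trace_int_Gamma g : is_trace u g ->
  int_Gamma g = (Num.sqrt 2)^-1 * int_Omega (grad_dot u (@G R)).
Proof.
move=> [/L2_GammaP Lg [phi [tphi cH cG]]].
have s2 := sqrt2_gt0; have s0 : Num.sqrt 2 != 0 :> R by rewrite gt_eqF.
(* Pairing with the constant 1 turns L^2 convergence on the diagonal into convergence of the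
   integrals. *)
have L1 : L2 leb I01 (cst 1 : R -> R).
  by apply: (@L2_bounded _ _ _ leb _ m01 f01 _ 1) => // t _; rewrite normr1.
have c2 : Int01 (fun t => ((phi n \o @diag R) t - (g \o @diag R) t) ^+ 2)
    @[n --> \oo] --> (0 : R).
  have -> : (fun n => Int01 (fun t => ((phi n \o @diag R) t - (g \o @diag R) t) ^+ 2)) =
      (fun n => (Num.sqrt 2)^-1 * (L2_Gamma_norm (phi n \- g) * L2_Gamma_norm (phi n \- g))).
    apply/funext => n; rewrite L2_Gamma_normE; last first.
      exact: (L2_sub m01 (test_fun_L2_diag (tphi n)) Lg).
    rewrite -expr2 sqr_sqrtr ?mulKf//; apply: mulr_ge0; first exact: ltW.
    by apply: Rintegral_ge0 => t _; exact: sqr_ge0.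
  rewrite -[X in _ --> X](mulr0 (Num.sqrt 2)^-1); apply: cvgMr.
  by rewrite -[X in _ --> X](mulr0 (0 : R)); exact: cvgM.
have c3 := cvg_L2_mul m01 (fun n => test_fun_L2_diag (tphi n)) Lg L1 c2.
have c4 : 2 * Int01 (fun t => phi n (t, t)) @[n --> \oo] --> 2 * Int01 (fun t => g (t, t)).
  apply: cvgMr; move: c3.
  have E (h : R -> R) : Int01 (fun t => h t * cst 1 t) = Int01 h.
    by apply: eq_Rintegral => t _; rewrite mulr1.
  by rewrite E; under eq_fun do rewrite E.
have <- : 2 * Int01 (fun t => g (t, t)) = int_Omega (grad_dot u (@G R)).
  exact: (cvg_unique _ c4 (cvg_grad_G tphi cH)).
rewrite int_GammaE; last exact: (L2_intble m01 f01 Lg).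
have ss : Num.sqrt 2 * Num.sqrt 2 = 2 :> R by rewrite -expr2 sqr_sqrtr.
by apply: (mulfI s0); rewrite mulrA ss mulVKf.
Qed.

End H1_convergence.
End trace.

Theorem theorem4p1 (R : realType) (f : source R) (u : R * R -> R)
    (hf : admissible f) (hu : weak_solution f u) :
  int_Gamma (trace u) = (Num.sqrt 2)^-1 * pairing f (@G R) /\
  (Num.sqrt 2)^-1 * pairing f (@G R)
    = (Num.sqrt 2)^-1 * int_Omega (grad_dot u (@G R)).
Proof.
have [[[Lu [gx ux] [gy uy]] dens] Hu] := hu.
rewrite -(Hu _ (H10_G R)); split=> //.
(* A witness ensures that [xget] in [trace u] returns an actual trace and not its default
   [cst 0]. *)
have [g ug] := is_trace_exists Lu ux uy dens.
apply: (is_trace_int_Gamma Lu ux uy).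
exact: (xgetI (cst 0) ug).
Qed.
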